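(* Let $\frac{s_1 \quad \cdots \quad s_n}{s}$ be an instance of one of the HOL deduction rules REFL, TRANS, MK\_COMB, ABS, BETA, ASSUME, EQ\_MP, DEDUCT\_ANTISYM\_RULE, INST, INSTTYPE, ETA (listed in the context). Then the rule $\frac{\lceil s_1\rceil \quad \cdots \quad \lceil s_n\rceil}{\lceil s\rceil}$ is admissible in FOST: if each of the first-order sequents $\lceil s_1\rceil,\dots,\lceil s_n\rceil$ is provable in first-order sequent calculus from the ZFC axioms (with the definitional symbols listed below), then so is $\lceil s\rceil$.
   Context: HOL here is higher-order logic as in HOL Light: simply typed lambda calculus with top-level polymorphism. Types are built from type variables, the type $\mathcal B$ of Booleans, the type $i$ of individuals, and arrow types $A\to B$. Terms are typed variables $x:A$, constants (including the polymorphic equality $=^\lambda : A\to A\to\mathcal B$, written $s=_A t$), applications $f\,t$ and abstractions $\lambda x{:}A.\,t$. An HOL sequent is $t_1,\dots,t_n\vdash t$ with all $t_j,t$ of type $\mathcal B$. The rules are: REFL: $\vdash t=_A t$. TRANS: from $\Gamma\vdash s=_A t$ and $\Delta\vdash t=_A u$ infer $\Gamma,\Delta\vdash s=_A u$ (the two occurrences of $t$ need only be alpha-equivalent). MK\_COMB: from $\Gamma\vdash s=_{A\to B} t$ and $\Delta\vdash u=_A v$ infer $\Gamma,\Delta\vdash s(u)=_B t(v)$. ABS: from $\Gamma\vdash s=_B t$ infer $\Gamma\vdash(\lambda x{:}A.\,s)=_{A\to B}(\lambda x{:}A.\,t)$. BETA: $\vdash(\lambda x{:}A.\,t)\,x=_B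 t$. ASSUME: $p\vdash p$. EQ\_MP: from $\Gamma\vdash p=_{\mathcal B} q$ and $\Delta\vdash p$ infer $\Gamma,\Delta\vdash q$ (the two occurrences of $p$ need only be alpha-equivalent). DEDUCT\_ANTISYM\_RULE: from $\Gamma,q\vdash p$ and $\Delta,p\vdash q$ infer $\Gamma,\Delta\vdash p=_{\mathcal B} q$. INST: from $\Gamma\vdash p$ infer $\Gamma[\vec x:=\vec t]\vdash p[\vec x:=\vec t]$ (substitution of terms for term variables). INSTTYPE: from $\Gamma\vdash p$ infer $\Gamma[\vec X:=\vec A]\vdash p[\vec X:=\vec A]$ (substitution of types for type variables). ETA: $\vdash(\lambda x.\,t\,x)=t$. FOST is ZFC in first-order logic (sequent calculus), conservatively extended by definitions with: $\mathrm{app}(f,x)$, the unique $y$ with $(x,y)\in f$ when $f$ is a function; $A\Rightarrow B=\{r\in\mathcal P(A\times B)\mid r \text{ is a total functional relation from } A \text{ to } B\}$; $\mathbb N$ the natural numbers; $\bot=\emptyset$, $\top=\{\emptyset\}$, $\mathbb B=\{\bot,\top\}$; and $E(A)=\{(x,f)\in A\times(A\Rightarrow\mathbb B)\mid f=\{(y,b)\in A\times\mathbb B\mid (x=y\to b=\top)\wedge(x\neq y\to b=\bot)\}\}$. Application is written by juxtaposition and is curried: $f\,a\,b$ means $\mathrm{app}(\mathrm{app}(f,a),b)$. Embedding $\lceil\cdot\rceil$ of HOL into FOST: a reserved set of first-order variables $\lambda_1,\lambda_2,\dots$ is used, one associated to each abstraction term. Type variables $X$ are mapped to first-order variables $X$;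 $\lceil T_1\to T_2\rceil=\lceil T_1\rceil\Rightarrow\lceil T_2\rceil$; $\lceil\mathcal B\rceil=\mathbb B$; $\lceil i\rceil=\mathbb N$; $\lceil x{:}A\rceil=x$; $\lceil =^\lambda:A\to A\to\mathcal B\rceil=E(\lceil A\rceil)$; $\lceil f\,t\rceil=\lceil f\rceil\,\lceil t\rceil$; $\lceil\lambda x{:}A.\,t\rceil=\lambda_i\,y_1\cdots y_n$, where $y_1,\dots,y_n$ are the free variables of $\lambda x.\,t$ and $\lambda_i$ is the variable associated with $\lambda x.\,t$. The context of an HOL term $t$ is $\mathrm{ctx}(t)=\mathrm{ctx}^N(t)\cup\mathrm{ctx}^T(t)\cup\mathrm{ctx}^D(t)$, where: $\mathrm{ctx}^N(t)$ is the set of formulas $X\neq\emptyset$ for every type variable $X$ occurring in $t$ (including in types of polymorphic constants); $\mathrm{ctx}^T$ is given by $\mathrm{ctx}^T(x{:}T)=\{x\in\lceil T\rceil\}$, $\mathrm{ctx}^T(c)=\emptyset$ for constants, $\mathrm{ctx}^T(f\,t)=\mathrm{ctx}^T(f)\cup\mathrm{ctx}^T(t)$, $\mathrm{ctx}^T(\lambda x{:}T.\,t)=\mathrm{ctx}^T(t)\setminus\{x\in\lceil T\rceil\}$; and $\mathrm{ctx}^D$ is given by $\mathrm{ctx}^D(x{:}T)=\mathrm{ctx}^D(c)=\emptyset$, $\mathrm{ctx}^D(f\,t)=\mathrm{ctx}^D(f)\cup\mathrm{ctx}^D(t)$, and $\mathrm{ctx}^D(\lambda x{:}T.\,t)=\mathrm{ctx}^D(t)\cup\{\lambda_i\in(\lceil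 T_1\rceil\Rightarrow\cdots\Rightarrow\lceil T_n\rceil\Rightarrow\lceil T\rceil\Rightarrow\lceil\tau\rceil)\ \wedge\ \forall y_1\in\lceil T_1\rceil\cdots\forall y_n\in\lceil T_n\rceil\,\forall x\in\lceil T\rceil.\ \lambda_i\,y_1\cdots y_n\,x=\lceil t\rceil\}$, where $\tau$ is the type of $t$, $y_1{:}T_1,\dots,y_n{:}T_n$ are the free variables of $t$ other than $x$, and $\lambda_i$ is the variable associated with $\lambda x.\,t$. The embedding of an HOL sequent $s=(t_1,\dots,t_n\vdash t)$ is the first-order sequent $\lceil s\rceil:=\ \mathrm{ctx}(t_1),\dots,\mathrm{ctx}(t_n),\mathrm{ctx}(t),\ \lceil t_1\rceil=\top,\dots,\lceil t_n\rceil=\top\ \vdash\ \lceil t\rceil=\top$.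
   Formalization: ABS is taken with the usual HOL Light side condition that x is not free in Γ, and ETA with x not free in t; without them the claim fails, e.g. x=y ⊢ x=y would yield x=y ⊢ (λx.x)=(λx.y). *)

(* Defs.v *)
From HB Require Import structures.
From Stdlib Require List.
From mathcomp Require Import all_boot.
Set Implicit Arguments.
Unset Strict Implicit.
Unset Printing Implicit Defensive.

(** * FOST: first-order set theory *)

(** First-order syntax is in de Bruijn style: [All] and [Ex] bind index 0, and
    indices beyond the enclosing binders are the free variables. *)

Inductive sym0 := SEmpty | SNat | SBot | STop | SBool.
Inductive sym1 := SPow | SEqf.
Inductive sym2 := SUpair | SProd | SArr | SApp.

Inductive term :=
| Var of nat
| Op0 of sym0
| Op1 of sym1 & term
| Op2 of sym2 & term & term.

Inductive form :=
| Mem of term & term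
| Eq of term & term
| Bot
| And of form & form
| Or of form & form
| Imp of form & form
| All of form
| Ex of form.

Lemma term_eq_dec : comparable term.
Proof. by move=> s t; rewrite /decidable; do! decide equality. Defined.
HB.instance Definition _ := hasDecEq.Build term (compareP term_eq_dec).

Lemma form_eq_dec : comparable form.
Proof.
by move=> p q; rewrite /decidable; decide equality; exact: term_eq_dec.
Defined.
HB.instance Definition _ := hasDecEq.Build form (compareP form_eq_dec).

Notation Not p := (Imp p Bot).
Notation Iff p q := (And (Imp p q) (Imp q p)).

Notation tEmpty := (Op0 SEmpty).
Notation tNat := (Op0 SNat).
Notation tBot := (Op0 SBot).
Notation tTop := (Op0 STop).
Notation tBool := (Op0 SBool).
Notation tPow A := (Op1 SPow A).
Notation tEqf A := (Op1 SEqf A).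
Notation tUpair a b := (Op2 SUpair a b).
Notation tProd A B := (Op2 SProd A B).
Notation tArr A B := (Op2 SArr A B).
Notation tApp f x := (Op2 SApp f x).
(* Kuratowski pairs *)
Notation tPair a b := (tUpair (tUpair a a) (tUpair a b)).

Declare Scope fo_scope.
Delimit Scope fo_scope with F.
Bind Scope fo_scope with form.
Notation "# n" := (Var n) (at level 2, n at level 1, format "# n") : fo_scope.
Notation "s ∈ t" := (Mem s t) (at level 70, no associativity) : fo_scope.
Notation "s ≐ t" := (Eq s t) (at level 70, no associativity) : fo_scope.
Notation "p ∧ q" := (And p q) (at level 80, right associativity) : fo_scope.
Notation "p ∨ q" := (Or p q) (at level 85, right associativity) : fo_scope.
Notation "p ⟶ q" := (Imp p q) (at level 90, right associativity) : fo_scope.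
Notation "p ⟷ q" := (Iff p q) (at level 95, no associativity) : fo_scope.
Local Open Scope fo_scope.

Fixpoint tsubst (s : nat -> term) (t : term) : term :=
  match t with
  | Var n => s n
  | Op0 c => Op0 c
  | Op1 f a => Op1 f (tsubst s a)
  | Op2 f a b => Op2 f (tsubst s a) (tsubst s b)
  end.

Definition tshift (t : term) : term := tsubst (fun n => #(n.+1)) t.

Definition up (s : nat -> term) (n : nat) : term :=
  if n is m.+1 then tshift (s m) else #0.

Fixpoint fsubst (s : nat -> term) (p : form) : form :=
  match p with
  | Mem a b => Mem (tsubst s a) (tsubst s b)
  | Eq a b => Eq (tsubst s a) (tsubst s b)
  | Bot => Bot
  | And p q => And (fsubst s p) (fsubst s q)
  | Or p q => Or (fsubst s p) (fsubst s q)
  | Imp p q => Imp (fsubst s p) (fsubst s q)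
  | All p => All (fsubst (up s) p)
  | Ex p => Ex (fsubst (up s) p)
  end.

Definition fren (r : nat -> nat) (p : form) : form :=
  fsubst (fun n => #(r n)) p.
Definition fshift (p : form) : form := fren S p.

Definition finst (t : term) (p : form) : form :=
  fsubst (fun n => if n is m.+1 then #m else t) p.

(** Quantification over the free variable [k], as in named syntax. *)
Definition all_var (k : nat) (p : form) : form :=
  All (fren (fun n => if n == k then 0 else n.+1) p).
Definition all_in (k : nat) (A : term) (p : form) : form :=
  all_var k (#k ∈ A ⟶ p).

(** ** Axioms *)

Definition inductive_set (I : term) : form :=
  tEmpty ∈ I ∧
  All (#0 ∈ tshift I ⟶
       Ex (#0 ∈ tshift (tshift I) ∧
           All (#0 ∈ #1 ⟷ (#0 ∈ #2 ∨ #0 ≐ #2)))).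

Definition is_function (f : term) : form :=
  Ex (Ex (tshift (tshift f) ∈ tArr #1 #0)).

(** The schemas range over all formulas of the language with the defined
    symbols; their remaining free variables are parameters. *)
Inductive ZFC_axiom : form -> Prop :=
| ax_extensionality :
    ZFC_axiom (All (All (All (#0 ∈ #2 ⟷ #0 ∈ #1) ⟶ #1 ≐ #0)))
| ax_pairing :
    ZFC_axiom (All (All (Ex (All (#0 ∈ #1 ⟷ (#0 ≐ #3 ∨ #0 ≐ #2))))))
| ax_union :
    ZFC_axiom (All (Ex (All (#0 ∈ #1 ⟷ Ex (#0 ∈ #3 ∧ #1 ∈ #0)))))
| ax_power :
    ZFC_axiom (All (Ex (All (#0 ∈ #1 ⟷ All (#0 ∈ #1 ⟶ #0 ∈ #3)))))
| ax_infinity :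
    ZFC_axiom (Ex (inductive_set #0))
| ax_foundation :
    ZFC_axiom (All (Ex (#0 ∈ #1) ⟶
                    Ex (#0 ∈ #1 ∧ All (#0 ∈ #1 ⟶ Not (#0 ∈ #2)))))
(* a set A of nonempty, pairwise disjoint sets has a transversal *)
| ax_choice :
    ZFC_axiom (All
      ((All (#0 ∈ #1 ⟶ Ex (#0 ∈ #1)) ∧
        All (All (#1 ∈ #2 ⟶ #0 ∈ #2 ⟶
                  All (#0 ∈ #2 ⟶ #0 ∈ #1 ⟶ #2 ≐ #1)))) ⟶
       Ex (All (#0 ∈ #2 ⟶
                Ex (All ((#0 ∈ #2 ∧ #0 ∈ #3) ⟷ #0 ≐ #1))))))
(* in p : #0 is x, #1 is A *)
| ax_separation (p : form) :
    ZFC_axiom (All (Ex (All (#0 ∈ #1 ⟷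
      (#0 ∈ #2 ∧ fren (fun n => if n is 0 then 0 else n.+1) p)))))
(* in p : #0 is y, #1 is x, #2 is A *)
| ax_replacement (p : form) :
    ZFC_axiom (All
      (All (#0 ∈ #1 ⟶
            All (All (fren S p ⟶
                      fren (fun n => if n is 0 then 0 else n.+1) p ⟶
                      #1 ≐ #0))) ⟶
       Ex (All (#0 ∈ #1 ⟷
                Ex (#0 ∈ #3 ∧
                    fren (fun n => match n with
                                   | 0 => 1 | 1 => 0 | m.+2 => m.+3
                                   end) p))))).

Inductive definition_axiom : form -> Prop :=
| def_empty :
    definition_axiom (All (Not (#0 ∈ tEmpty)))
| def_upair :
    definition_axiom (All (All (All
      (#0 ∈ tUpair #2 #1 ⟷ (#0 ≐ #2 ∨ #0 ≐ #1)))))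
| def_pow :
    definition_axiom (All (All
      (#0 ∈ tPow #1 ⟷ All (#0 ∈ #1 ⟶ #0 ∈ #2))))
| def_prod :
    definition_axiom (All (All (All
      (#0 ∈ tProd #2 #1 ⟷
       Ex (Ex (#1 ∈ #4 ∧ #0 ∈ #3 ∧ #2 ≐ tPair #1 #0))))))
| def_arr :
    definition_axiom (All (All (All
      (#0 ∈ tArr #2 #1 ⟷
       (#0 ∈ tPow (tProd #2 #1) ∧
        All (#0 ∈ #3 ⟶
             Ex (tPair #1 #0 ∈ #2 ∧
                 All (tPair #2 #0 ∈ #3 ⟶ #0 ≐ #1))))))))
(* app(f,x) = y; the value is the empty set when f is not a function or x is
   not in its domain *)
| def_app :
    definition_axiom (All (All (All
      (tApp #2 #1 ≐ #0 ⟷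
       ((is_function #2 ∧ tPair #1 #0 ∈ #2) ∨
        (Not (is_function #2 ∧ Ex (tPair #2 #0 ∈ #3)) ∧ #0 ≐ tEmpty))))))
| def_nat :
    definition_axiom (All
      (#0 ∈ tNat ⟷ All (inductive_set #0 ⟶ #1 ∈ #0)))
| def_bot :
    definition_axiom (tBot ≐ tEmpty)
| def_top :
    definition_axiom (tTop ≐ tUpair tEmpty tEmpty)
| def_bool :
    definition_axiom (tBool ≐ tUpair tBot tTop)
(* A = #1, z = #0; then x = #1, f = #0; then w = #0; then y = #1, b = #0 *)
| def_eqf :
    definition_axiom (All (All
      (#0 ∈ tEqf #1 ⟷
       Ex (Ex (#2 ≐ tPair #1 #0 ∧ #1 ∈ #3 ∧ #0 ∈ tArr #3 tBool ∧
               All (#0 ∈ #1 ⟷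
                    Ex (Ex (#2 ≐ tPair #1 #0 ∧ #1 ∈ #6 ∧ #0 ∈ tBool ∧
                            (#4 ≐ #1 ⟶ #0 ≐ tTop) ∧
                            (Not (#4 ≐ #1) ⟶ #0 ≐ tBot))))))))).

Definition FOST_axiom (p : form) : Prop := ZFC_axiom p \/ definition_axiom p.

(** ** Sequent calculus *)

(** Sequents are pairs of finite sets, represented by lists; [lk_struct] is
    weakening, contraction and exchange. *)
Inductive FOST_provable : seq form -> seq form -> Prop :=
| lk_axiom p : FOST_axiom p -> FOST_provable [::] [:: p]
| lk_hyp p : FOST_provable [:: p] [:: p]
| lk_struct G D G' D' :
    {subset G <= G'} -> {subset D <= D'} ->
    FOST_provable G D -> FOST_provable G' D'
| lk_cut G D p :
    FOST_provable G (p :: D) -> FOST_provable (p :: G) D -> FOST_provable G D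
| lk_botL : FOST_provable [:: Bot] [::]
| lk_andL G D p q :
    FOST_provable (p :: q :: G) D -> FOST_provable (And p q :: G) D
| lk_andR G D p q :
    FOST_provable G (p :: D) -> FOST_provable G (q :: D) ->
    FOST_provable G (And p q :: D)
| lk_orL G D p q :
    FOST_provable (p :: G) D -> FOST_provable (q :: G) D ->
    FOST_provable (Or p q :: G) D
| lk_orR G D p q :
    FOST_provable G (p :: q :: D) -> FOST_provable G (Or p q :: D)
| lk_impL G D p q :
    FOST_provable G (p :: D) -> FOST_provable (q :: G) D ->
    FOST_provable (Imp p q :: G) D
| lk_impR G D p q :
    FOST_provable (p :: G) (q :: D) -> FOST_provable G (Imp p q :: D)
| lk_allL G D p t :
    FOST_provable (finst t p :: G) D -> FOST_provable (All p :: G) D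
| lk_allR G D p :
    FOST_provable (map fshift G) (p :: map fshift D) ->
    FOST_provable G (All p :: D)
| lk_exL G D p :
    FOST_provable (p :: map fshift G) (map fshift D) ->
    FOST_provable (Ex p :: G) D
| lk_exR G D p t :
    FOST_provable G (finst t p :: D) -> FOST_provable G (Ex p :: D)
| lk_eq_refl t : FOST_provable [::] [:: t ≐ t]
| lk_eq_subst s t p :
    FOST_provable [:: s ≐ t; finst s p] [:: finst t p].

(** * HOL *)

Inductive ty := TyVar of nat | TyBool | TyInd | TyArr of ty & ty.

Fixpoint ty_code (A : ty) : GenTree.tree nat :=
  match A with
  | TyVar X => GenTree.Leaf X
  | TyBool => GenTree.Node 0 [::]
  | TyInd => GenTree.Node 1 [::]
  | TyArr A B => GenTree.Node 2 [:: ty_code A; ty_code B]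
  end.
Fixpoint ty_decode (c : GenTree.tree nat) : option ty :=
  match c with
  | GenTree.Leaf X => Some (TyVar X)
  | GenTree.Node 0 [::] => Some TyBool
  | GenTree.Node 1 [::] => Some TyInd
  | GenTree.Node 2 [:: a; b] =>
      if (ty_decode a, ty_decode b) is (Some A, Some B)
      then Some (TyArr A B) else None
  | _ => None
  end.
Lemma ty_codeK : pcancel ty_code ty_decode.
Proof. by elim=> //= A -> B ->. Qed.
HB.instance Definition _ := Countable.copy ty (pcan_type ty_codeK).

(** A variable is a name together with a type: x:A and x:B are different
    variables when A and B differ. *)
Notation hvar := (nat * ty)%type.

(** [HEq A] is the instance of equality of type A -> A -> Bool. *)
Inductive tm :=
| HVar of hvar
| HEq of ty
| HApp of tm & tm
| HLam of hvar & tm.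

Fixpoint tm_code (t : tm) : GenTree.tree (hvar + ty) :=
  match t with
  | HVar x => GenTree.Node 0 [:: GenTree.Leaf (inl x)]
  | HEq A => GenTree.Leaf (inr A)
  | HApp f a => GenTree.Node 1 [:: tm_code f; tm_code a]
  | HLam x t => GenTree.Node 2 [:: GenTree.Leaf (inl x); tm_code t]
  end.
Fixpoint tm_decode (c : GenTree.tree (hvar + ty)) : option tm :=
  match c with
  | GenTree.Node 0 [:: GenTree.Leaf (inl x)] => Some (HVar x)
  | GenTree.Leaf (inr A) => Some (HEq A)
  | GenTree.Node 1 [:: a; b] =>
      if (tm_decode a, tm_decode b) is (Some f, Some u)
      then Some (HApp f u) else None
  | GenTree.Node 2 [:: GenTree.Leaf (inl x); b] =>
      if tm_decode b is Some t then Some (HLam x t) else None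
  | _ => None
  end.
Lemma tm_codeK : pcancel tm_code tm_decode.
Proof. by elim=> //= [f -> a -> | x t ->]. Qed.
HB.instance Definition _ := Countable.copy tm (pcan_type tm_codeK).

(** The type of a term; meaningful on well-typed terms only. *)
Fixpoint tyof (t : tm) : ty :=
  match t with
  | HVar x => x.2
  | HEq A => TyArr A (TyArr A TyBool)
  | HApp f _ => if tyof f is TyArr _ B then B else TyBool
  | HLam x t => TyArr x.2 (tyof t)
  end.

Fixpoint wt (t : tm) : bool :=
  match t with
  | HVar _ | HEq _ => true
  | HApp f a =>
      [&& wt f, wt a & if tyof f is TyArr A _ then tyof a == A else false]
  | HLam _ t => wt t
  end.

Definition heq (A : ty) (s t : tm) : tm := HApp (HApp (HEq A) s) t.

(** Free variables, without repetition. *)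
Fixpoint fv (t : tm) : seq hvar :=
  match t with
  | HVar x => [:: x]
  | HEq _ => [::]
  | HApp f a => undup (fv f ++ fv a)
  | HLam x t => [seq y <- fv t | y != x]
  end.

Fixpoint ty_tyvars (A : ty) : seq nat :=
  match A with
  | TyVar X => [:: X]
  | TyBool | TyInd => [::]
  | TyArr A B => ty_tyvars A ++ ty_tyvars B
  end.

Fixpoint tyvars (t : tm) : seq nat :=
  match t with
  | HVar x => ty_tyvars x.2
  | HEq A => ty_tyvars A
  | HApp f a => tyvars f ++ tyvars a
  | HLam x t => ty_tyvars x.2 ++ tyvars t
  end.

(** [alpha_in e s t]: s and t are alpha-equivalent when the variables paired in
    e (innermost first) are bound to each other. *)
Fixpoint alpha_var (e : seq (hvar * hvar)) (x y : hvar) : bool :=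
  if e is (a, b) :: e' then
    if x == a then y == b else (y != b) && alpha_var e' x y
  else x == y.

Fixpoint alpha_in (e : seq (hvar * hvar)) (s t : tm) : bool :=
  match s, t with
  | HVar x, HVar y => alpha_var e x y
  | HEq A, HEq B => A == B
  | HApp f a, HApp g b => alpha_in e f g && alpha_in e a b
  | HLam x s, HLam y t => (x.2 == y.2) && alpha_in ((x, y) :: e) s t
  | _, _ => false
  end.

Definition alpha (s t : tm) : bool := alpha_in [::] s t.

(** ** Substitution *)

Fixpoint ty_subst (r : nat -> ty) (A : ty) : ty :=
  match A with
  | TyVar X => r X
  | TyBool => TyBool
  | TyInd => TyInd
  | TyArr A B => TyArr (ty_subst r A) (ty_subst r B)
  end.

Definition variant (avoid : seq hvar) (x : hvar) : hvar :=
  if x \in avoid then ((\max_(y <- avoid) y.1).+1, x.2) else x.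

(** Simultaneous capture-avoiding substitution of types for type variables and
    of terms for term variables. A bound variable is renamed only where it would
    capture; under [ty_subst r], binding x:A can also capture x:B when A and B
    become equal. *)
Fixpoint tm_subst (r : nat -> ty) (s : hvar -> tm) (t : tm) : tm :=
  match t with
  | HVar x => s x
  | HEq A => HEq (ty_subst r A)
  | HApp f a => HApp (tm_subst r s f) (tm_subst r s a)
  | HLam x t =>
      let avoid := flatten [seq fv (s y) | y <- fv (HLam x t)] in
      let x' := variant avoid (x.1, ty_subst r x.2) in
      HLam x' (tm_subst r (fun y => if y == x then HVar x' else s y) t)
  end.

Fixpoint assoc (K : eqType) (V : Type) (l : seq (K * V)) (k : K) : option V :=
  if l is (k', v) :: l' then if k == k' then Some v else assoc l' k else None.

Definition term_inst (l : seq (hvar * tm)) : tm -> tm :=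
  tm_subst TyVar (fun x => odflt (HVar x) (assoc l x)).

Definition type_inst (l : seq (nat * ty)) : tm -> tm :=
  let r X := odflt (TyVar X) (assoc l X) in
  tm_subst r (fun x => HVar (x.1, ty_subst r x.2)).

(** ** Deduction rules *)

Record hsequent := HSequent { hyps : seq tm; concl : tm }.

Definition wf_sequent (s : hsequent) : bool :=
  all (fun t => wt t && (tyof t == TyBool)) (concl s :: hyps s).

Definition same_sequent (s s' : hsequent) : Prop :=
  hyps s =i hyps s' /\ concl s = concl s'.

(** The types of the terms involved are not mentioned when they are forced by
    the sequents being well formed. *)
Inductive hol_rule : seq hsequent -> hsequent -> Prop :=
| REFL A t :
    hol_rule [::] (HSequent [::] (heq A t t))
| TRANS G D A s t t' u : alpha t t' ->
    hol_rule [:: HSequent G (heq A s t); HSequent D (heq A t' u)]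
             (HSequent (G ++ D) (heq A s u))
| MK_COMB G D A B s t u v :
    hol_rule [:: HSequent G (heq (TyArr A B) s t); HSequent D (heq A u v)]
             (HSequent (G ++ D) (heq B (HApp s u) (HApp t v)))
| ABS G B x s t : (forall p, p \in G -> x \notin fv p) ->
    hol_rule [:: HSequent G (heq B s t)]
             (HSequent G (heq (TyArr x.2 B) (HLam x s) (HLam x t)))
| BETA B x t :
    hol_rule [::] (HSequent [::] (heq B (HApp (HLam x t) (HVar x)) t))
| ASSUME p :
    hol_rule [::] (HSequent [:: p] p)
| EQ_MP G D p p' q : alpha p p' ->
    hol_rule [:: HSequent G (heq TyBool p q); HSequent D p']
             (HSequent (G ++ D) q)
| DEDUCT_ANTISYM_RULE G D p q :
    hol_rule [:: HSequent (q :: G) p; HSequent (p :: D) q]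
             (HSequent (G ++ D) (heq TyBool p q))
| INST G p (l : seq (hvar * tm)) :
    uniq (unzip1 l) ->
    (forall x t, (x, t) \in l -> wt t /\ tyof t = x.2) ->
    hol_rule [:: HSequent G p]
             (HSequent (map (term_inst l) G) (term_inst l p))
| INSTTYPE G p (l : seq (nat * ty)) :
    uniq (unzip1 l) ->
    hol_rule [:: HSequent G p]
             (HSequent (map (type_inst l) G) (type_inst l p))
| ETA A B x t : x \notin fv t ->
    hol_rule [::]
      (HSequent [::] (heq (TyArr A B) (HLam x (HApp t (HVar x))) t)).

(** Antecedents are finite sets: the rules apply up to the order and repetition
    of hypotheses. *)
Definition hol_instance (ps : seq hsequent) (s : hsequent) : Prop :=
  [/\ forall p, List.In p ps -> wf_sequent p,
      wf_sequent s &
      exists ps' s',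
        [/\ List.Forall2 same_sequent ps ps', same_sequent s s'
          & hol_rule ps' s']].

(** * Embedding of HOL into FOST *)

(** The HOL entities that are represented by a first-order variable. *)
Inductive hsym :=
| SymTy of nat
| SymVar of hvar
| SymLam of hvar & tm.

(** Distinct type variables, variables and abstraction terms are represented by
    distinct first-order variables. *)
Record naming := Naming { fo :> hsym -> nat; fo_inj : injective fo }.

Definition naming_default : naming.
Proof.
pose f h := match h with
  | SymTy X => pickle (inl (inl X) : nat + hvar + hvar * tm)%type
  | SymVar x => pickle (inl (inr x) : nat + hvar + hvar * tm)%type
  | SymLam x t => pickle (inr (x, t) : nat + hvar + hvar * tm)%type
  end.
exists f => -[X|x|x t] [Y|y|y u] /(pcan_inj pickleK) //.
- by case=> ->.
- by move=> [->].
- by move=> [-> ->].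
Defined.

Fixpoint emb_ty (nu : naming) (A : ty) : term :=
  match A with
  | TyVar X => #(nu (SymTy X))
  | TyBool => tBool
  | TyInd => tNat
  | TyArr A B => tArr (emb_ty nu A) (emb_ty nu B)
  end.

Definition emb_var (nu : naming) (x : hvar) : term := #(nu (SymVar x)).

Definition apps (f : term) (xs : seq term) : term :=
  foldl (fun g x => tApp g x) f xs.

Fixpoint emb (nu : naming) (t : tm) : term :=
  match t with
  | HVar x => emb_var nu x
  | HEq A => tEqf (emb_ty nu A)
  | HApp f a => tApp (emb nu f) (emb nu a)
  | HLam x t => apps #(nu (SymLam x t)) (map (emb_var nu) (fv (HLam x t)))
  end.

Definition typing (nu : naming) (x : hvar) : form :=
  emb_var nu x ∈ emb_ty nu x.2.

(** The formula defining the variable associated with the abstraction of x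
    in t. *)
Definition lam_def (nu : naming) (x : hvar) (t : tm) : form :=
  let lam := #(nu (SymLam x t)) in
  let ys := rcons (fv (HLam x t)) x in
  (lam ∈ foldr (fun y B => tArr (emb_ty nu y.2) B) (emb_ty nu (tyof t)) ys) ∧
  foldr (fun y p => all_in (nu (SymVar y)) (emb_ty nu y.2) p)
        (apps lam (map (emb_var nu) ys) ≐ emb nu t) ys.

Definition ctxN (nu : naming) (t : tm) : seq form :=
  [seq Not (#(nu (SymTy X)) ≐ tEmpty) | X <- tyvars t].

Fixpoint ctxT (nu : naming) (t : tm) : seq form :=
  match t with
  | HVar x => [:: typing nu x]
  | HEq _ => [::]
  | HApp f a => ctxT nu f ++ ctxT nu a
  | HLam x t => [seq p <- ctxT nu t | p != typing nu x]
  end.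

Fixpoint ctxD (nu : naming) (t : tm) : seq form :=
  match t with
  | HVar _ | HEq _ => [::]
  | HApp f a => ctxD nu f ++ ctxD nu a
  | HLam x t => ctxD nu t ++ [:: lam_def nu x t]
  end.

Definition ctx (nu : naming) (t : tm) : seq form :=
  ctxN nu t ++ ctxT nu t ++ ctxD nu t.

Definition emb_provable (nu : naming) (s : hsequent) : Prop :=
  FOST_provable
    (flatten (map (ctx nu) (hyps s)) ++ ctx nu (concl s) ++
     [seq emb nu t ≐ tTop | t <- hyps s])
    [:: emb nu (concl s) ≐ tTop].

(* Main.v *)
Require Import Defs.
From mathcomp Require Import all_boot.
From mathcomp Require Import boolp.
Set Implicit Arguments.
Unset Strict Implicit.
Unset Printing Implicit Defensive.
Local Open Scope fo_scope.

(** By soundness and completeness of the sequent calculus, the rule is admissible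
    as soon as it preserves truth in every model [M] of FOST; completeness holds by
    a Henkin construction. Inside [M] an HOL term [t]
    has a denotation [den tau v t] that does not mention the variables reserved
    for abstractions: [HLam x t] denotes the graph of [a |-> den t v[x := a]],
    which is an element of [M] by separation because denotations are definable by
    formulas. In an environment satisfying [ctx t] the embedded term evaluates to
    [den t]; conversely every well-typed assignment to type and term variables
    extends to the reserved variables, the one of [HLam x t] receiving the
    denotation of the closure of [HLam x t] under abstraction. Hence the embedded
    sequent is provable iff the HOL sequent holds, in every model, for all
    assignments with nonempty types, and for that semantics the rules are sound
    by the usual coincidence and substitution lemmas. The variables and
    abstractions that occur in the premises only cause no problem, since they can
    always be interpreted. *)

(** * Substitution *)

Lemma tsubst_comp s r t :
  tsubst s (tsubst r t) = tsubst (fun n => tsubst s (r n)) t.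
Proof. by elim: t => //= [f a -> | f a -> b ->]. Qed.

Lemma tsubst_var t : tsubst Var t = t.
Proof. by elim: t => //= [f a -> | f a -> b ->]. Qed.

Lemma up_comp s r :
  (fun n => tsubst (up s) (up r n)) = up (fun n => tsubst s (r n)).
Proof. by apply: funext => -[|n] //=; rewrite /tshift !tsubst_comp. Qed.

Lemma up_var : up Var = Var.
Proof. by apply: funext => -[]. Qed.

Lemma fsubst_comp s r p :
  fsubst s (fsubst r p) = fsubst (fun n => tsubst s (r n)) p.
Proof.
elim: p s r => //= [a b|a b|p IHp q IHq|p IHp q IHq|p IHp q IHq|p IHp|p IHp] s r;
  by rewrite ?tsubst_comp ?IHp ?IHq ?up_comp.
Qed.

Lemma fsubst_var p : fsubst Var p = p.
Proof.
elim: p => //= [a b|a b|p IHp q IHq|p IHp q IHq|p IHp q IHq|p IHp|p IHp];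
  by rewrite ?tsubst_var ?up_var ?IHp ?IHq.
Qed.

Lemma fsubst_finst s t p :
  fsubst s (finst t p) = finst (tsubst s t) (fsubst (up s) p).
Proof.
rewrite /finst !fsubst_comp; congr fsubst; apply: funext => -[|n] //=.
by rewrite /tshift tsubst_comp tsubst_var.
Qed.

Lemma fsubst_up_fshift s p : fsubst (up s) (fshift p) = fshift (fsubst s p).
Proof. by rewrite /fshift /fren !fsubst_comp. Qed.

Lemma map_fsubst_up s G :
  map (fsubst (up s)) (map fshift G) = map fshift (map (fsubst s) G).
Proof. by rewrite -!map_comp; apply: eq_map => p /=; rewrite fsubst_up_fshift. Qed.

(** Outside the two schemas all axioms are closed and hence unchanged; a schema instance becomes the
    instance for the substituted formula, lifted past the variables that the schema binds in it. *)
Lemma FOST_axiom_subst s p : FOST_axiom p -> FOST_axiom (fsubst s p).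
Proof.
case=> [[]|[]]; try (by left; constructor); try (by right; constructor).
- move=> q; left; rewrite /= /fren fsubst_comp.
  rewrite (_ : fsubst _ q = fren (fun n => if n is 0 then 0 else n.+1)
    (fsubst (up (up s)) q)); first exact: ax_separation.
  rewrite /fren fsubst_comp; congr fsubst; apply: funext => -[|[|n]] //=.
  by rewrite /tshift !tsubst_comp.
- move=> q; left; rewrite /= /fren !fsubst_comp.
  have := ax_replacement (fsubst (up (up (up s))) q).
  rewrite /fren !fsubst_comp; congr (ZFC_axiom (All (Imp
    (All (Imp _ (All (All (Imp (fsubst _ q) (Imp (fsubst _ q) _))))))
    (Ex (All (And (Imp _ (Ex (And _ (fsubst _ q))))
      (Imp (Ex (And _ (fsubst _ q))) _)))))));
    apply: funext => -[|[|[|n]]] //=; by rewrite /tshift !tsubst_comp.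
Qed.

Lemma FOST_provable_subst s G D :
  FOST_provable G D ->
  FOST_provable (map (fsubst s) G) (map (fsubst s) D).
Proof.
move=> H; elim: H s => {G D} /=.
- by move=> p Hp s; apply: lk_axiom; apply: FOST_axiom_subst.
- by move=> p s; apply: lk_hyp.
- move=> G D G' D' sG sD _ IH s; apply: lk_struct (IH s).
    by move=> _ /mapP[p /sG pG ->]; apply: map_f.
  by move=> _ /mapP[p /sD pD ->]; apply: map_f.
- by move=> G D p _ IH1 _ IH2 s; apply: lk_cut (IH1 s) (IH2 s).
- by move=> s; apply: lk_botL.
- by move=> G D p q _ IH s; apply: lk_andL (IH s).
- by move=> G D p q _ IH1 _ IH2 s; apply: lk_andR (IH1 s) (IH2 s).
- by move=> G D p q _ IH1 _ IH2 s; apply: lk_orL (IH1 s) (IH2 s).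
- by move=> G D p q _ IH s; apply: lk_orR (IH s).
- by move=> G D p q _ IH1 _ IH2 s; apply: lk_impL (IH1 s) (IH2 s).
- by move=> G D p q _ IH s; apply: lk_impR (IH s).
- by move=> G D p t _ IH s; move: (IH s); rewrite fsubst_finst; apply: lk_allL.
- by move=> G D p _ IH s; move: (IH (up s)); rewrite !map_fsubst_up; apply: lk_allR.
- by move=> G D p _ IH s; move: (IH (up s)); rewrite !map_fsubst_up; apply: lk_exL.
- by move=> G D p t _ IH s; move: (IH s); rewrite fsubst_finst; apply: lk_exR.
- by move=> t s; apply: lk_eq_refl.
- by move=> a b p s; rewrite !fsubst_finst; apply: lk_eq_subst.
Qed.

(* Strict upper bounds on the free variables. *)
Fixpoint tbound (t : term) : nat :=
  match t with
  | Var n => n.+1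
  | Op0 _ => 0
  | Op1 _ a => tbound a
  | Op2 _ a b => maxn (tbound a) (tbound b)
  end.

Fixpoint fbound (p : form) : nat :=
  match p with
  | Defs.Mem a b | Eq a b => maxn (tbound a) (tbound b)
  | Bot => 0
  | And p q | Or p q | Imp p q => maxn (fbound p) (fbound q)
  | All p | Ex p => (fbound p).-1
  end.

Lemma eq_tsubst s r t :
  (forall n, n < tbound t -> s n = r n) -> tsubst s t = tsubst r t.
Proof.
elim: t => //= [n|f a IH|f a IHa b IHb] H; first by apply: H.
  by rewrite IH.
by rewrite IHa ?IHb // => n Hn; apply: H; rewrite leq_max Hn ?orbT.
Qed.

Lemma eq_fsubst s r p :
  (forall n, n < fbound p -> s n = r n) -> fsubst s p = fsubst r p.
Proof.
have eq_up (m : nat) (s0 r0 : nat -> term) : (forall n, n < m.-1 -> s0 n = r0 n) ->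
    forall n, n < m -> up s0 n = up r0 n.
  by move=> H [|n] //= Hn; rewrite H //; case: m Hn {H}.
elim: p s r => //= [a b|a b|p IHp q IHq|p IHp q IHq|p IHp q IHq|p IHp|p IHp] s r H.
- by rewrite (@eq_tsubst s r a) ?(@eq_tsubst s r b) // => n Hn; apply: H; rewrite leq_max Hn ?orbT.
- by rewrite (@eq_tsubst s r a) ?(@eq_tsubst s r b) // => n Hn; apply: H; rewrite leq_max Hn ?orbT.
- by rewrite (IHp s r) ?(IHq s r) // => n Hn; apply: H; rewrite leq_max Hn ?orbT.
- by rewrite (IHp s r) ?(IHq s r) // => n Hn; apply: H; rewrite leq_max Hn ?orbT.
- by rewrite (IHp s r) ?(IHq s r) // => n Hn; apply: H; rewrite leq_max Hn ?orbT.
- by rewrite (IHp _ _ (eq_up _ _ _ H)).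
- by rewrite (IHp _ _ (eq_up _ _ _ H)).
Qed.

(** * Quantifier rules with a named eigenvariable *)

Section EigenVariable.
Variables (G D : seq form) (p : form) (c : nat).
Hypothesis cG : forall q, q \in p :: G ++ D -> fbound q <= c.

(** Turns [c] into index 0 and shifts all other variables. Where [c] is not free this is the plain
    shift, and it sends the instance of [p] at [c] back to [p], so a premise with a named
    eigenvariable takes de Bruijn form. *)
Let sig n : term := if n == c then #0 else #(n.+1).

Let sig_fshift q : q \in p :: G ++ D -> fsubst sig q = fshift q.
Proof.
move=> /cG qc; apply: eq_fsubst => n Hn; rewrite /sig ifN //.
by rewrite neq_ltn (leq_trans Hn qc).
Qed.

Let sig_map L : {subset L <= p :: G ++ D} -> map (fsubst sig) L = map fshift L.
Proof. by move=> H; apply/eq_in_map => q /H; apply: sig_fshift. Qed.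

Let sig_finst : fsubst sig (finst #c p) = p.
Proof.
rewrite -[RHS]fsubst_var /finst fsubst_comp; apply: eq_fsubst => -[|n] Hn /=.
  by rewrite /sig eqxx.
rewrite /sig ifN // neq_ltn (leq_trans _ (cG (mem_head _ _))) //.
exact: ltnW.
Qed.

Let subG : {subset G <= p :: G ++ D}.
Proof. by move=> q qG; rewrite inE mem_cat qG orbT. Qed.
Let subD : {subset D <= p :: G ++ D}.
Proof. by move=> q qG; rewrite inE mem_cat qG !orbT. Qed.

Lemma lk_exL_fresh :
  FOST_provable (finst #c p :: G) D -> FOST_provable (Ex p :: G) D.
Proof.
move/(FOST_provable_subst sig) => /=.
by rewrite sig_finst !sig_map //; apply: lk_exL.
Qed.

Lemma lk_allR_fresh :
  FOST_provable G (finst #c p :: D) -> FOST_provable G (All p :: D).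
Proof.
move/(FOST_provable_subst sig) => /=.
by rewrite sig_finst !sig_map //; apply: lk_allR.
Qed.
End EigenVariable.

(** * Tarski semantics *)

Record structure := Structure {
  dom :> Type;
  smem : dom -> dom -> Prop;
  sop0 : sym0 -> dom;
  sop1 : sym1 -> dom -> dom;
  sop2 : sym2 -> dom -> dom -> dom }.

Definition scons (T : Type) (a : T) (rho : nat -> T) (n : nat) : T :=
  if n is m.+1 then rho m else a.

Fixpoint eval (M : structure) (rho : nat -> M) (t : term) : M :=
  match t with
  | Var n => rho n
  | Op0 c => sop0 M c
  | Op1 f a => sop1 f (eval rho a)
  | Op2 f a b => sop2 f (eval rho a) (eval rho b)
  end.

Fixpoint sat (M : structure) (rho : nat -> M) (p : form) : Prop :=
  match p with
  | Defs.Mem a b => smem (eval rho a) (eval rho b)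
  | Eq a b => eval rho a = eval rho b
  | Bot => False
  | And p q => sat rho p /\ sat rho q
  | Or p q => sat rho p \/ sat rho q
  | Imp p q => sat rho p -> sat rho q
  | All p => forall a, sat (scons a rho) p
  | Ex p => exists a, sat (scons a rho) p
  end.

Lemma eval_tsubst (M : structure) (rho : nat -> M) s t :
  eval rho (tsubst s t) = eval (fun n => eval rho (s n)) t.
Proof. by elim: t => //= [f a -> | f a -> b ->]. Qed.

Lemma eval_up (M : structure) (a : M) rho s :
  (fun n => eval (scons a rho) (up s n)) = scons a (fun n => eval rho (s n)).
Proof. by apply: funext => -[|n] //=; rewrite /tshift eval_tsubst. Qed.

Lemma sat_fsubst (M : structure) (rho : nat -> M) s p :
  sat rho (fsubst s p) = sat (fun n => eval rho (s n)) p.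
Proof.
elim: p rho s => //=
  [a b|a b|p IHp q IHq|p IHp q IHq|p IHp q IHq|p IHp|p IHp] rho s;
  rewrite ?eval_tsubst ?IHp ?IHq //.
  by apply: eq_forall => a; rewrite IHp eval_up.
by congr ex; apply: funext => a; rewrite IHp eval_up.
Qed.

Lemma sat_fren (M : structure) (rho : nat -> M) r p :
  sat rho (fren r p) = sat (rho \o r) p.
Proof. exact: sat_fsubst. Qed.

Lemma sat_fshift (M : structure) (a : M) rho p :
  sat (scons a rho) (fshift p) = sat rho p.
Proof. exact: sat_fren. Qed.

Lemma sat_finst (M : structure) (rho : nat -> M) t p :
  sat rho (finst t p) = sat (scons (eval rho t) rho) p.
Proof. by rewrite sat_fsubst; congr sat; apply: funext => -[]. Qed.

Definition FOST_model (M : structure) : Prop :=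
  forall p, FOST_axiom p -> forall rho : nat -> M, sat rho p.

(** * Sequents under a valuation, and soundness of the calculus *)

Section Valuation.
Variable V : form -> Prop.

Definition all_true (G : seq form) := forall p, p \in G -> V p.
Definition some_true (D : seq form) := exists2 p, p \in D & V p.

Lemma all_true_nil : all_true [::] = True.
Proof. by apply/propext; split. Qed.

Lemma all_true_cons p G : all_true (p :: G) = (V p /\ all_true G).
Proof.
apply/propext; split=> [H|[Hp H] q].
  by split=> [|q qG]; apply: H; rewrite inE ?eqxx ?qG ?orbT.
by rewrite inE => /predU1P[->|/H].
Qed.

Lemma some_true_nil : some_true [::] = False.
Proof. by apply/propext; split=> // -[]. Qed.

Lemma some_true_cons p D : some_true (p :: D) = (V p \/ some_true D).
Proof.
apply/propext; split=> [[q]|[Hp|[q qD Hq]]].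
- by rewrite inE => /predU1P[->|]; [left | right; exists q].
- by exists p => //; rewrite inE eqxx.
- by exists q => //; rewrite inE qD orbT.
Qed.
End Valuation.

Definition true_consE := (all_true_nil, all_true_cons, some_true_nil, some_true_cons).

Lemma all_true_map_fshift (M : structure) (a : M) rho G :
  all_true (sat (scons a rho)) (map fshift G) = all_true (sat rho) G.
Proof. by elim: G => /= [|p G IH]; rewrite ?true_consE // sat_fshift IH. Qed.

Lemma some_true_map_fshift (M : structure) (a : M) rho G :
  some_true (sat (scons a rho)) (map fshift G) = some_true (sat rho) G.
Proof. by elim: G => /= [|p G IH]; rewrite ?true_consE // sat_fshift IH. Qed.

Theorem soundness (M : structure) (rho : nat -> M) G D :
  FOST_model M -> FOST_provable G D ->
  all_true (sat rho) G -> some_true (sat rho) D.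
Proof.
move=> HM H; elim: H rho => {G D} /=.
- by move=> p /HM Hp rho _; exists p; rewrite ?mem_head.
- by move=> p rho; rewrite !true_consE; tauto.
- move=> G D G' D' sG sD _ IH rho HG.
  by have [p /sD pD Hp] := IH rho (fun p pG => HG p (sG p pG)); exists p.
- move=> G D p _ IH1 _ IH2 rho HG.
  by move: (IH1 rho) (IH2 rho); rewrite !true_consE; tauto.
- by move=> rho; rewrite !true_consE /=; tauto.
- by move=> G D p q _ IH rho; move: (IH rho); rewrite !true_consE /=; tauto.
- by move=> G D p q _ IH1 _ IH2 rho; move: (IH1 rho) (IH2 rho); rewrite !true_consE /=; tauto.
- by move=> G D p q _ IH1 _ IH2 rho; move: (IH1 rho) (IH2 rho); rewrite !true_consE /=; tauto.
- by move=> G D p q _ IH rho; move: (IH rho); rewrite !true_consE /=; tauto.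
- by move=> G D p q _ IH1 _ IH2 rho; move: (IH1 rho) (IH2 rho); rewrite !true_consE /=; tauto.
- move=> G D p q _ IH rho; move: (IH rho) (EM (sat rho p)).
  by rewrite !true_consE /=; tauto.
- move=> G D p t _ IH rho; move: (IH rho); rewrite !true_consE /= sat_finst.
  by move=> H [Hp HG]; apply: H; split.
- move=> G D p _ IH rho HG; rewrite true_consE /=.
  have [|nD] := EM (some_true (sat rho) D); [by right | left=> a].
  move: (IH (scons a rho)).
  by rewrite !true_consE all_true_map_fshift some_true_map_fshift; tauto.
- move=> G D p _ IH rho; rewrite true_consE /= => -[[a Hp] HG].
  move: (IH (scons a rho)).
  by rewrite !true_consE all_true_map_fshift some_true_map_fshift; tauto.
- move=> G D p t _ IH rho HG; move: (IH rho HG); rewrite !true_consE /= sat_finst.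
  by case=> [Hp|]; [left; exists (eval rho t) | right].
- by move=> t rho _; rewrite !true_consE /=; left.
- move=> s t p rho; rewrite !true_consE /= !sat_finst => -[-> [Hp _]].
  by left.
Qed.

(** * Henkin completeness *)

Definition sym0_code c :=
  match c with SEmpty => 0 | SNat => 1 | SBot => 2 | STop => 3 | SBool => 4 end.
Definition sym1_code c := match c with SPow => 0 | SEqf => 1 end.
Definition sym2_code c :=
  match c with SUpair => 0 | SProd => 1 | SArr => 2 | SApp => 3 end.

Fixpoint term_code (t : term) : GenTree.tree nat :=
  match t with
  | Var n => GenTree.Leaf n
  | Op0 c => GenTree.Node (sym0_code c) [::]
  | Op1 f a => GenTree.Node (sym1_code f) [:: term_code a]
  | Op2 f a b => GenTree.Node (sym2_code f) [:: term_code a; term_code b]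
  end.

Fixpoint term_decode (c : GenTree.tree nat) : term :=
  match c with
  | GenTree.Leaf n => #n
  | GenTree.Node k [::] => Op0 (nth SEmpty [:: SEmpty; SNat; SBot; STop; SBool] k)
  | GenTree.Node k [:: a] => Op1 (nth SPow [:: SPow; SEqf] k) (term_decode a)
  | GenTree.Node k (a :: b :: _) =>
      Op2 (nth SUpair [:: SUpair; SProd; SArr; SApp] k) (term_decode a) (term_decode b)
  end.

Lemma term_codeK : cancel term_code term_decode.
Proof. by elim=> //= [[]|[] a ->|[] a -> b ->]. Qed.

Fixpoint form_code (p : form) : GenTree.tree nat :=
  match p with
  | Defs.Mem a b => GenTree.Node 0 [:: term_code a; term_code b]
  | Eq a b => GenTree.Node 1 [:: term_code a; term_code b]
  | Bot => GenTree.Node 2 [::]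
  | And p q => GenTree.Node 3 [:: form_code p; form_code q]
  | Or p q => GenTree.Node 4 [:: form_code p; form_code q]
  | Imp p q => GenTree.Node 5 [:: form_code p; form_code q]
  | All p => GenTree.Node 6 [:: form_code p]
  | Ex p => GenTree.Node 7 [:: form_code p]
  end.

Fixpoint form_decode (c : GenTree.tree nat) : form :=
  match c with
  | GenTree.Node 0 [:: a; b] => term_decode a ∈ term_decode b
  | GenTree.Node 1 [:: a; b] => term_decode a ≐ term_decode b
  | GenTree.Node 3 [:: a; b] => form_decode a ∧ form_decode b
  | GenTree.Node 4 [:: a; b] => form_decode a ∨ form_decode b
  | GenTree.Node 5 [:: a; b] => form_decode a ⟶ form_decode b
  | GenTree.Node 6 [:: a] => All (form_decode a)
  | GenTree.Node 7 [:: a] => Ex (form_decode a)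
  | _ => Bot
  end.

Lemma form_codeK : cancel form_code form_decode.
Proof.
by elim=> //= [a b|a b|p -> q ->|p -> q ->|p -> q ->|p ->|p ->]; rewrite ?term_codeK.
Qed.

(** Enumerates all formulas; indices that code nothing give [Bot]. *)
Definition form_nth (n : nat) : form := oapp form_decode Bot (unpickle n).

Lemma form_nth_surj p : exists n, form_nth n = p.
Proof. by exists (pickle (form_code p)); rewrite /form_nth pickleK /= form_codeK. Qed.

Ltac sublist := by move=> ?; rewrite ?(in_cons, mem_cat);
  do ?[case/orP]; move=> ->; rewrite ?orbT.

(** * Henkin extension of an unprovable sequent *)

Section Henkin.
Variables G0 D0 : seq form.
Hypothesis unprovable0 : ~ FOST_provable G0 D0.

(** As [fbound] is a strict bound, the variable with this index is free in no formula of [L]. *)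
Definition fresh (L : seq form) : nat := \max_(q <- L) fbound q.

Lemma fbound_fresh L q : q \in L -> fbound q <= fresh L.
Proof. by move=> qL; rewrite /fresh (big_rem q) //= leq_maxl. Qed.

(** Meant for a quantified formula [r] with body [p]: the bound of [r] is no larger, so a variable
    chosen fresh for the body is fresh for [r] too. *)
Lemma fresh_body p r (G D L : seq form) :
  fbound r <= fbound p -> (forall q, q \in L -> q \in r :: p :: G ++ D) ->
  forall q, q \in L -> fbound q <= fresh (p :: G ++ D).
Proof.
move=> rp sL q /sL; rewrite inE => /predU1P[->|]; last exact: fbound_fresh.
by apply: leq_trans rp _; apply: fbound_fresh; rewrite mem_head.
Qed.

Definition witness (GD : seq form * seq form) (p : form) : term :=
  #(fresh (p :: GD.1 ++ GD.2)).

(** Decides [p]: it goes left whenever this keeps the sequent unprovable, and right otherwise. A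
    universal formula on the right brings a counterexample and an existential one on the left a
    witness, both at a fresh variable. *)
Definition henkin_step (GD : seq form * seq form) (p : form) :=
  if `[< FOST_provable (p :: GD.1) GD.2 >] then
    (GD.1, (if p is All q then [:: finst (witness GD q) q] else [::]) ++ p :: GD.2)
  else
    ((if p is Ex q then [:: finst (witness GD q) q] else [::]) ++ p :: GD.1, GD.2).

Fixpoint henkin (n : nat) : seq form * seq form :=
  if n is m.+1 then henkin_step (henkin m) (form_nth m) else (G0, D0).

(** Cut shows that one of the two sides is safe. The added instance is harmless: its fresh variable
    serves as the eigenvariable of the quantifier rule, applied to a second copy of the formula that
    is then contracted. *)
Lemma henkin_step_unprovable GD p :
  ~ FOST_provable GD.1 GD.2 ->
  ~ FOST_provable (henkin_step GD p).1 (henkin_step GD p).2.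
Proof.
case: GD => G D /= nGD; rewrite /henkin_step /=; case: asboolP => /= pGD.
  have npGD : ~ FOST_provable G (p :: D) by move=> H; exact: nGD (lk_cut H pGD).
  case: p pGD npGD => //= p _ npGD H; apply: npGD.
  apply: (@lk_struct G (All p :: All p :: D)); [sublist | sublist |].
  apply: (lk_allR_fresh (c := fresh (p :: G ++ D))).
  by apply: (@fresh_body p (All p)); [exact: leq_pred | sublist].
  apply: lk_struct H => //; sublist.
case: p pGD => //= p npGD H; apply: npGD.
apply: (@lk_struct (Ex p :: Ex p :: G) D); [sublist | sublist |].
apply: (lk_exL_fresh (c := fresh (p :: G ++ D))).
  by apply: (@fresh_body p (Ex p)); [exact: leq_pred | sublist].
apply: lk_struct H => //; sublist.
Qed.

(** The limit theory; its complement is the union of the right sides. *)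
Definition Gamma (p : form) : Prop := exists n, p \in (henkin n).1.

Lemma henkin_sub m n : m <= n ->
  {subset (henkin m).1 <= (henkin n).1} /\ {subset (henkin m).2 <= (henkin n).2}.
Proof.
move=> /subnK <-; elim: (n - m) => [|k [IH1 IH2]] /=; first by split.
rewrite /henkin_step; case: asboolP => _ /=; split=> // p.
- by move/IH2 => H; rewrite mem_cat in_cons H !orbT.
- by move/IH1 => H; rewrite mem_cat in_cons H !orbT.
Qed.

Lemma henkin_unprovable n : ~ FOST_provable (henkin n).1 (henkin n).2.
Proof. by elim: n => //= n; apply: henkin_step_unprovable. Qed.

Lemma henkin_stage p : exists n,
  [/\ p \in (henkin n).1 & (forall q, p = Ex q -> exists t, finst t q \in (henkin n).1)] \/
  [/\ p \in (henkin n).2 & (forall q, p = All q -> exists t, finst t q \in (henkin n).2)].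
Proof.
have [n <-] := form_nth_surj p; exists n.+1 => /=.
rewrite /henkin_step; case: asboolP => _ /=; [right | left].
  split=> [|q ->]; first by rewrite mem_cat mem_head orbT.
  by exists (witness (henkin n) q); rewrite mem_cat mem_head.
split=> [|q ->]; first by rewrite mem_cat mem_head orbT.
by exists (witness (henkin n) q); rewrite mem_cat mem_head.
Qed.

Lemma Gamma_consistent p n : Gamma p -> p \in (henkin n).2 -> False.
Proof.
move=> [m pm] pn; apply: (@henkin_unprovable (maxn m n)).
have [/(_ _ pm) pG _] := henkin_sub (leq_maxl m n).
have [_ /(_ _ pn) pD] := henkin_sub (leq_maxr m n).
apply: lk_struct (lk_hyp p) => q; rewrite in_cons orbF => /eqP -> //.
Qed.

Lemma Gamma_or p : Gamma p \/ exists n, p \in (henkin n).2.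
Proof.
by have [n [[pn _]|[pn _]]] := henkin_stage p; [left | right]; exists n.
Qed.

(** Otherwise [G] lies in the left sides and [D] in the right sides; both are finite, so one stage
    contains them and would be provable by weakening. The clauses for the connectives below are read
    off from this and the rules of the calculus. *)
Lemma Gamma_closed G D : FOST_provable G D -> all_true Gamma G -> some_true Gamma D.
Proof.
move=> GD HG; apply: contrapT => HD.
have [n1 H1] : exists n, {subset G <= (henkin n).1}.
  elim: G HG {GD} => [|p G IH]; first by exists 0.
  rewrite true_consE => -[[m pm] /IH[n sn]]; exists (maxn m n) => q.
  rewrite in_cons => /predU1P[->|/sn].
    by have [+ _] := henkin_sub (leq_maxl m n); apply.
  by have [+ _] := henkin_sub (leq_maxr m n); apply.
have [n2 H2] : exists n, {subset D <= (henkin n).2}.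
  elim: D HD {GD} => [|p D IH]; first by exists 0.
  rewrite true_consE => /not_orP[np /IH[n sn]].
  have [//|[m pm]] := Gamma_or p.
  exists (maxn m n) => q; rewrite in_cons => /predU1P[->|/sn].
    by have [_ +] := henkin_sub (leq_maxl m n); apply.
  by have [_ +] := henkin_sub (leq_maxr m n); apply.
apply: (@henkin_unprovable (maxn n1 n2)).
have [s1 _] := henkin_sub (leq_maxl n1 n2).
have [_ s2] := henkin_sub (leq_maxr n1 n2).
by apply: lk_struct GD => q; [move/H1/s1 | move/H2/s2].
Qed.

Lemma Gamma_ax p : FOST_axiom p -> Gamma p.
Proof.
by move=> /lk_axiom/Gamma_closed; rewrite !true_consE => /(_ I) [].
Qed.

Lemma Gamma_Bot : ~ Gamma Bot.
Proof. by have := Gamma_closed lk_botL; rewrite !true_consE; tauto. Qed.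

Lemma Gamma_And p q : Gamma (p ∧ q) <-> Gamma p /\ Gamma q.
Proof.
have hp : FOST_provable [:: p; q] [:: p] by apply: lk_struct (lk_hyp p) => //; sublist.
have hq : FOST_provable [:: p; q] [:: q] by apply: lk_struct (lk_hyp q) => //; sublist.
move: (Gamma_closed (lk_andL hp)) (Gamma_closed (lk_andL hq)) (Gamma_closed (lk_andR hp hq)).
by rewrite !true_consE; tauto.
Qed.

Lemma Gamma_Or p q : Gamma (p ∨ q) <-> Gamma p \/ Gamma q.
Proof.
have hp : FOST_provable [:: p] [:: p; q] by apply: lk_struct (lk_hyp p) => //; sublist.
have hq : FOST_provable [:: q] [:: p; q] by apply: lk_struct (lk_hyp q) => //; sublist.
move: (Gamma_closed (lk_orR hp)) (Gamma_closed (lk_orR hq)) (Gamma_closed (lk_orL hp hq)).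
by rewrite !true_consE; tauto.
Qed.

Lemma Gamma_Imp p q : Gamma (p ⟶ q) <-> (Gamma p -> Gamma q).
Proof.
have hp : FOST_provable [:: p] [:: p; q] by apply: lk_struct (lk_hyp p) => //; sublist.
have hp' : FOST_provable [:: p] [:: q; p] by apply: lk_struct (lk_hyp p) => //; sublist.
have hq : FOST_provable [:: p; q] [:: q] by apply: lk_struct (lk_hyp q) => //; sublist.
have hq' : FOST_provable [:: q; p] [:: q] by apply: lk_struct (lk_hyp q) => //; sublist.
move: (Gamma_closed (lk_impR hp')) (Gamma_closed (lk_impR hq)) (Gamma_closed (lk_impL hp hq')).
have [] := EM (Gamma p); by rewrite !true_consE; tauto.
Qed.

Lemma Gamma_Ex p : Gamma (Ex p) <-> exists t, Gamma (finst t p).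
Proof.
split=> [Hp|[t]].
  have [n [[_ /(_ _ erefl)[t tn]]|[pn _]]] := henkin_stage (Ex p).
    by exists t, n.
  by case: (Gamma_consistent Hp pn).
have := Gamma_closed (lk_exR (lk_hyp (finst t p))).
by rewrite !true_consE; tauto.
Qed.

Lemma Gamma_All p : Gamma (All p) <-> forall t, Gamma (finst t p).
Proof.
split=> [Hp t|Hp].
  have := Gamma_closed (lk_allL (lk_hyp (finst t p))).
  by rewrite !true_consE; tauto.
have [n [[pn _]|[_ /(_ _ erefl)[t tn]]]] := henkin_stage (All p); first by exists n.
by case: (Gamma_consistent (Hp t) tn).
Qed.

Lemma Gamma_refl t : Gamma (t ≐ t).
Proof. by have := Gamma_closed (lk_eq_refl t); rewrite !true_consE => /(_ I) []. Qed.

Lemma Gamma_subst s t p : Gamma (s ≐ t) -> Gamma (finst s p) -> Gamma (finst t p).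
Proof. by have := Gamma_closed (lk_eq_subst s t p); rewrite !true_consE; tauto. Qed.

Let finst_tshift s t : tsubst (fun n => if n is m.+1 then #m else s) (tshift t) = t.
Proof. by rewrite /tshift tsubst_comp tsubst_var. Qed.

Lemma Gamma_sym s t : Gamma (s ≐ t) -> Gamma (t ≐ s).
Proof.
move=> st; have := @Gamma_subst s t (#0 ≐ tshift s) st.
by rewrite /finst /= !finst_tshift; apply; apply: Gamma_refl.
Qed.

Lemma Gamma_trans s t u : Gamma (s ≐ t) -> Gamma (t ≐ u) -> Gamma (s ≐ u).
Proof.
move=> st tu; have := @Gamma_subst t u (tshift s ≐ #0) tu.
by rewrite /finst /= !finst_tshift; apply.
Qed.

(** The hypothesis on [F] says that it fills the hole [#0] of a fixed term [F']; the replacement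
    rule then applies to the right-hand side of [F s ≐ F s]. *)
Lemma Gamma_congr s t (F : term -> term) :
  Gamma (s ≐ t) -> (exists F', forall x, F x = tsubst (fun n => if n is m.+1 then #m else x) F') ->
  Gamma (F s ≐ F t).
Proof.
move=> st [F' HF]; have := @Gamma_subst s t (tshift (F s) ≐ F') st.
by rewrite /finst /= !finst_tshift -!HF; apply; apply: Gamma_refl.
Qed.

Lemma Gamma_Mem s s' t t' :
  Gamma (s ≐ s') -> Gamma (t ≐ t') -> Gamma (s ∈ t) -> Gamma (s' ∈ t').
Proof.
move=> ss tt.
have := @Gamma_subst s s' (#0 ∈ tshift t) ss; have := @Gamma_subst t t' (tshift s' ∈ #0) tt.
by rewrite /finst /= !finst_tshift; tauto.
Qed.

(** * The term model: terms modulo equality in the theory *)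

Definition eq_class (t u : term) : Prop := Gamma (t ≐ u).

Lemma eq_class_eq s t : (eq_class s = eq_class t) <-> Gamma (s ≐ t).
Proof.
split=> [E|st]; first by rewrite -/(eq_class s t) E; apply: Gamma_refl.
apply: funext => u; apply/propext; split; last exact: Gamma_trans.
exact/Gamma_trans/Gamma_sym.
Qed.

(** The quotient consists of the equivalence classes as predicates, so that equality in the model is
    genuine equality; representatives come from choice. *)
Definition carrier := {P : term -> Prop | exists t, P = eq_class t}.
Definition cls (t : term) : carrier := exist _ (eq_class t) (ex_intro _ t erefl).
Definition repr (d : carrier) : term := projT1 (cid (projT2 d)).

Lemma reprK d : cls (repr d) = d.
Proof.
by rewrite /repr; case: d => P HP /=; case: cid => t /= E; apply: eq_exist.
Qed.

Lemma cls_eq s t : (cls s = cls t) <-> Gamma (s ≐ t).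
Proof.
rewrite -eq_class_eq; split=> [[] //|E]; exact: eq_exist.
Qed.

Lemma repr_cls t : Gamma (repr (cls t) ≐ t).
Proof. by apply/cls_eq; rewrite reprK. Qed.

Definition term_model : structure :=
  @Structure carrier
    (fun a b => Gamma (repr a ∈ repr b))
    (fun c => cls (Op0 c))
    (fun f a => cls (Op1 f (repr a)))
    (fun f a b => cls (Op2 f (repr a) (repr b))).

Lemma eval_term_model (s : nat -> term) t :
  @eval term_model (fun n => cls (s n)) t = cls (tsubst s t).
Proof.
elim: t => //= [f a ->|f a -> b ->].
  apply/cls_eq/(@Gamma_congr _ _ (Op1 f)); first exact: repr_cls.
  by exists (Op1 f #0).
apply/cls_eq/Gamma_trans.
  apply: (@Gamma_congr _ _ (fun x => Op2 f x _) (repr_cls _)).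
  by exists (Op2 f #0 (tshift (repr (cls (tsubst s b))))) => x /=; rewrite finst_tshift.
apply: (@Gamma_congr _ _ (fun x => Op2 f _ x) (repr_cls _)).
by exists (Op2 f (tshift (tsubst s a)) #0) => x /=; rewrite finst_tshift.
Qed.

(** This is the truth lemma: every element of the model is the class of a term, so quantifying over
    the model and over terms is the same. *)
Lemma sat_term_model (s : nat -> term) p :
  @sat term_model (fun n => cls (s n)) p <-> Gamma (fsubst s p).
Proof.
have scons_cls (t : term) (r : nat -> term) :
    scons (cls t) (fun n => cls (r n)) = (fun n => cls (scons t r n)).
  by apply: funext => -[].
have finst_up (t : term) (r : nat -> term) q :
    finst t (fsubst (up r) q) = fsubst (scons t r) q.
  rewrite /finst fsubst_comp; congr fsubst; apply: funext => -[|n] //=.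
elim: p s => /= [a b|a b||p IHp q IHq|p IHp q IHq|p IHp q IHq|p IHp|p IHp] s.
- rewrite !eval_term_model; split; apply: Gamma_Mem;
    by [exact: repr_cls | exact/Gamma_sym/repr_cls].
- by rewrite !eval_term_model; exact: cls_eq.
- by split=> // /Gamma_Bot.
- by rewrite Gamma_And IHp IHq.
- by rewrite Gamma_Or IHp IHq.
- by rewrite Gamma_Imp IHp IHq.
- rewrite Gamma_All; split=> [H t|H d].
    by rewrite finst_up; apply/IHp; have := H (cls t); rewrite scons_cls.
  by rewrite -(reprK d) scons_cls; apply/IHp; rewrite -finst_up.
- rewrite Gamma_Ex; split=> [[d]|[t]].
    by rewrite -(reprK d) scons_cls => /IHp H; exists (repr d); rewrite finst_up.
  by rewrite finst_up => /IHp; rewrite -scons_cls; exists (cls t).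
Qed.

Lemma term_model_FOST : FOST_model term_model.
Proof.
move=> p ax rho.
have -> : rho = (fun n => cls (repr (rho n))) by apply: funext => n; rewrite reprK.
by apply/sat_term_model/Gamma_ax/FOST_axiom_subst.
Qed.

Lemma term_model_countermodel :
  all_true (@sat term_model (fun n => cls #n)) G0 /\
  ~ some_true (@sat term_model (fun n => cls #n)) D0.
Proof.
split=> [p pG|[p pD]]; first by apply/sat_term_model; rewrite fsubst_var; exists 0.
by move/sat_term_model; rewrite fsubst_var => /(@Gamma_consistent _ 0); apply.
Qed.
End Henkin.

Theorem completeness G D :
  (forall M : structure, FOST_model M -> forall rho : nat -> M,
     all_true (sat rho) G -> some_true (sat rho) D) ->
  FOST_provable G D.
Proof.
move=> H; apply: contrapT => /[dup] unp /term_model_countermodel [HG]; apply.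
by apply: H => //; apply: term_model_FOST.
Qed.

(** * Set theory inside a model *)

Lemma typing_inj nu : injective (typing nu).
Proof. by move=> x y [] /(@fo_inj nu)[]. Qed.

(** Distinct variables have distinct typing formulas, so the removal of a formula under a binder
    matches the removal of the bound variable from [fv]. *)
Lemma mem_ctxT nu t p : p \in ctxT nu t <-> exists2 x, x \in fv t & p = typing nu x.
Proof.
elim: t => [x|A|f IHf a IHa|x t IHt] /=.
- by rewrite inE; split=> [/eqP ->|[y]]; [exists x; rewrite ?mem_head|rewrite inE => /eqP -> ->].
- by split=> // -[].
- rewrite mem_cat; split=> [/orP[/IHf[x Hx ->]|/IHa[x Hx ->]]|[x]].
  + by exists x; rewrite // mem_undup mem_cat Hx.
  + by exists x; rewrite // mem_undup mem_cat Hx orbT.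
  rewrite mem_undup mem_cat => /orP[] Hx e; apply/orP.
    by left; apply/IHf; exists x.
  by right; apply/IHa; exists x.
- rewrite mem_filter; split=> [/andP[ne /IHt[y Hy e]]|[y]].
    by exists y; rewrite // mem_filter Hy andbT; apply: contraNneq ne => <-; rewrite e.
  rewrite mem_filter => /andP[yx Hy] e; rewrite {1}e (inj_eq (@typing_inj nu)) yx /=.
  by apply/IHt; exists y.
Qed.

Lemma tyvars_tyof t : wt t -> {subset ty_tyvars (tyof t) <= tyvars t}.
Proof.
elim: t => /= [x|A|f IHf a IHa|x t IHt] //.
- by move=> _ X.
- by move=> _ X; rewrite !mem_cat in_nil orbF orbb.
- move=> /and3P[/IHf + _ +] X; case: (tyof f) => //= A B H _ HX.
  by rewrite mem_cat H // mem_cat HX orbT.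
- by move=> /IHt H X; rewrite !mem_cat => /orP[->|/H ->]; rewrite ?orbT.
Qed.

Lemma fv_tyvars t x : x \in fv t -> {subset ty_tyvars x.2 <= tyvars t}.
Proof.
elim: t => [y|A|f IHf a IHa|y t IHt] //=.
- by rewrite inE => /eqP -> X.
- rewrite mem_undup mem_cat => /orP[/IHf|/IHa] H X /H HX; by rewrite mem_cat HX ?orbT.
- by rewrite mem_filter => /andP[_ /IHt H] X /H HX; rewrite mem_cat HX orbT.
Qed.

Section Model.
Variable M : structure.
Hypothesis HM : FOST_model M.

Local Notation "a \in' b" := (@smem M a b) (at level 70, no associativity).
Local Notation empty := (sop0 M SEmpty).
Local Notation bot := (sop0 M SBot).
Local Notation top := (sop0 M STop).
Local Notation boolset := (sop0 M SBool).
Local Notation upair := (@sop2 M SUpair).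
Local Notation pair a b := (upair (upair a a) (upair a b)).
Local Notation prod := (@sop2 M SProd).
Local Notation arr := (@sop2 M SArr).
Local Notation app := (@sop2 M SApp).
Local Notation eqf := (@sop1 M SEqf).

Let rho0 : nat -> M := fun _ => empty.

(** * Pairs, functions and truth values in a model *)

Lemma extensionality (a b : M) : (forall z, z \in' a <-> z \in' b) -> a = b.
Proof.
by move=> H; apply: (HM (or_introl ax_extensionality) rho0 a b) => z; apply: H.
Qed.

Lemma separation p (rho : nat -> M) (A : M) :
  exists S, forall z, z \in' S <-> z \in' A /\ sat (scons z rho) p.
Proof.
(* In the axiom, index 1 of the formula is the set itself; the renaming makes [p] skip it. *)
have /= /(_ A)[S] := HM (or_introl (ax_separation
  (fren (fun n => if n is 0 then 0 else n.+1) p))) rho.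
rewrite /fren => HS; exists S => z; move: (HS z); rewrite !sat_fsubst /=.
by rewrite (_ : (fun n => _) = scons z rho) //; apply: funext => -[].
Qed.

Lemma mem_empty (z : M) : ~ z \in' empty.
Proof. exact: (HM (or_intror def_empty) rho0 z). Qed.

Lemma mem_upair (a b z : M) : z \in' upair a b <-> z = a \/ z = b.
Proof. exact: (HM (or_intror def_upair) rho0 a b z). Qed.

Lemma mem_prod (A B z : M) : z \in' prod A B <->
  exists a b, [/\ a \in' A, b \in' B & z = pair a b].
Proof.
have /= [H1 H2] := HM (or_intror def_prod) rho0 A B z.
split=> [/H1[a [b [? [? ?]]]]|[a [b [? ? ?]]]]; first by exists a, b.
by apply: H2; exists a, b.
Qed.

Lemma pair_inj (a b c d : M) : pair a b = pair c d -> a = c /\ b = d.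
Proof.
move=> E.
have H z : (z = upair a a \/ z = upair a b) <-> (z = upair c c \/ z = upair c d).
  by rewrite -!mem_upair E.
have E2 x y x' y' : upair x y = upair x' y' -> forall z, (z = x \/ z = y) <-> (z = x' \/ z = y').
  by move=> e z; rewrite -!mem_upair e.
have ac : a = c.
  have [/E2 e|/E2 e] := (H (upair a a)).1 (or_introl erefl).
    by case: ((e a).1 (or_introl erefl)).
  by case: ((e c).2 (or_introl erefl)).
subst c; split=> //.
(* If [upair a b] is the singleton of [a] then [b = a], and matching [upair a d] in the other
   direction forces [d = a] as well. *)
have [/E2/(_ b)|/E2 e] := (H (upair a b)).1 (or_intror erefl).
  by have [/E2/(_ d)|/E2/(_ d)] := (H (upair a d)).2 (or_intror erefl); intuition congruence.
by move: (e b) (e d); intuition congruence.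
Qed.

Lemma mem_arr (A B f : M) : f \in' arr A B <->
  (forall z, z \in' f -> z \in' prod A B) /\
  (forall a, a \in' A -> exists b, pair a b \in' f /\
     forall b', pair a b' \in' f -> b' = b).
Proof.
have /= [H1 H2] := HM (or_intror def_arr) rho0 A B f.
have /= [H3 H4] := HM (or_intror def_pow) rho0 (prod A B) f.
by split=> [/H1[/H3]|[/H4 ? ?]]; [ | apply: H2].
Qed.

Definition function (f : M) := exists A B, f \in' arr A B.

Lemma appE (f x y : M) : app f x = y <->
  (function f /\ pair x y \in' f) \/
  (~ (function f /\ exists z, pair x z \in' f) /\ y = empty).
Proof.
by have /= [H1 H2] := HM (or_intror def_app) rho0 f x y.
Qed.

Lemma app_pair (A B f a : M) : f \in' arr A B -> a \in' A -> pair a (app f a) \in' f.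
Proof.
move=> Hf Ha; have [_ /(_ _ Ha)[b [Hb _]]] := (mem_arr A B f).1 Hf.
have -> // : app f a = b by apply/appE; left; split=> //; exists A, B.
Qed.

Lemma pair_app (A B f a b : M) : f \in' arr A B -> pair a b \in' f -> app f a = b.
Proof. by move=> Hf Hab; apply/appE; left; split=> //; exists A, B. Qed.

Lemma arr_pair (A B f a b : M) : f \in' arr A B -> pair a b \in' f ->
  a \in' A /\ b \in' B.
Proof.
move=> /mem_arr[H _] /H /mem_prod[a' [b' [Ha Hb /pair_inj[-> ->]]]].
by split.
Qed.

Lemma app_in (A B f a : M) : f \in' arr A B -> a \in' A -> app f a \in' B.
Proof. by move=> Hf Ha; have [] := arr_pair Hf (app_pair Hf Ha). Qed.

Lemma arr_ext (A B f g : M) : f \in' arr A B -> g \in' arr A B ->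
  (forall a, a \in' A -> app f a = app g a) -> f = g.
Proof.
move=> Hf Hg E.
have sub f' g' : f' \in' arr A B -> g' \in' arr A B ->
    (forall a, a \in' A -> app f' a = app g' a) -> forall z, z \in' f' -> z \in' g'.
  move=> Hf' Hg' E' z Hz.
  have /mem_prod[a [b [Ha Hb e]]] := ((mem_arr A B f').1 Hf').1 _ Hz.
  move: Hz; rewrite e => Hz; rewrite -(pair_app Hf' Hz) E' //.
  exact: app_pair Hg' Ha.
apply: extensionality => z; split; first exact: sub.
by apply: sub => // a Ha; rewrite E.
Qed.

Lemma botE : bot = empty.
Proof. exact: (HM (or_intror def_bot) rho0). Qed.

Lemma top_neq_bot : top <> bot.
Proof.
have -> : top = upair empty empty by exact: (HM (or_intror def_top) rho0).
move=> E; apply: (@mem_empty empty); rewrite -{2}botE -E.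
by apply/mem_upair; left.
Qed.

Lemma mem_bool (b : M) : b \in' boolset <-> b = bot \/ b = top.
Proof.
have -> : boolset = upair bot top by exact: (HM (or_intror def_bool) rho0).
exact: mem_upair.
Qed.

Lemma top_in_bool : top \in' boolset.
Proof. by apply/mem_bool; right. Qed.

Lemma bool_ext (a b : M) : a \in' boolset -> b \in' boolset ->
  (a = top <-> b = top) -> a = b.
Proof.
move=> /mem_bool[->|->] /mem_bool[->|->] // [H1 H2]; last by rewrite H1.
by rewrite H2.
Qed.

Lemma empty_in_nat : empty \in' sop0 M SNat.
Proof.
have /= [_ H] := HM (or_intror def_nat) rho0 empty.
by apply: H => a [].
Qed.

(** ** Functions with a definable graph *)

(** The clause [F a \in' B] keeps the graph inside the product, so that separation yields it for a
    definable [F] even when [F] does not map [A] into [B]. *)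
Definition graph_spec (A B : M) (F : M -> M) (g : M) : Prop :=
  forall z, z \in' g <-> exists a, [/\ a \in' A, F a \in' B & z = pair a (F a)].

Lemma graph_in_arr A B F g : graph_spec A B F g ->
  (forall a, a \in' A -> F a \in' B) -> g \in' arr A B.
Proof.
move=> Hg HF; apply/mem_arr; split=> [z /Hg[a [Ha Hb ->]]|a Ha].
  by apply/mem_prod; exists a, (F a).
exists (F a); split=> [|b' /Hg[a' [_ _ /pair_inj[-> ->]]] //].
by apply/Hg; exists a; split=> //; apply: HF.
Qed.

Lemma graph_app A B F g a : graph_spec A B F g ->
  (forall a, a \in' A -> F a \in' B) -> a \in' A -> app g a = F a.
Proof.
move=> Hg HF Ha; apply: pair_app (graph_in_arr Hg HF) _.
by apply/Hg; exists a; split=> //; apply: HF.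
Qed.

(** Chosen classically so that [den] is total; for functions arising from HOL terms the set exists
    and the default is never taken. *)
Definition graph (A B : M) (F : M -> M) : M :=
  if pselect (exists g, graph_spec A B F g) is left h then projT1 (cid h) else empty.

Lemma graphP A B F : (exists g, graph_spec A B F g) -> graph_spec A B F (graph A B F).
Proof. by move=> h; rewrite /graph; case: pselect => // h'; case: cid. Qed.

Lemma graph_spec_inj A B F g g' :
  graph_spec A B F g -> graph_spec A B F g' -> g = g'.
Proof.
by move=> H H'; apply: extensionality => z; split=> [/H/H'|/H'/H].
Qed.

Lemma eq_graph A B F G : (forall a, a \in' A -> F a = G a) -> graph A B F = graph A B G.
Proof.
move=> E; suff e : graph_spec A B F = graph_spec A B G by rewrite /graph e.
have E' a b : [/\ a \in' A, F a \in' B & b = pair a (F a)] <->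
    [/\ a \in' A, G a \in' B & b = pair a (G a)].
  by split=> -[Ha Hb ->]; [rewrite E // in Hb * | rewrite -E // in Hb *].
apply: funext => g; apply/propext; split=> H z; split.
- by move=> /H[a /E' Ha]; exists a.
- by move=> [a /E' Ha]; apply/H; exists a.
- by move=> /H[a /E' Ha]; exists a.
- by move=> [a /E' Ha]; apply/H; exists a.
Qed.

(* A semantic operation on environments whose graph is given by a formula; the
   value is variable 0 and the environment starts at variable 1. *)
Definition definable (F : (nat -> M) -> M) : Prop :=
  exists p, forall rho y, sat (scons y rho) p <-> y = F rho.

Definition update (I : eqType) (T : Type) (rho : I -> T) (k : I) (a : T) (i : I) : T :=
  if i == k then a else rho i.

Lemma definable_term t : definable (fun rho => eval rho t).
Proof.
by exists (#0 ≐ tshift t) => rho y; rewrite /= /tshift eval_tsubst.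
Qed.

Lemma definable_app F G :
  definable F -> definable G -> definable (fun rho => app (F rho) (G rho)).
Proof.
move=> [p Hp] [q Hq].
(* Below the two quantifiers index 0 is the argument, 1 the function and 2 the value; the
   environment starts at 3. *)
pose p' := fren (fun n => if n is 0 then 1 else n.+2) p.
pose q' := fren (fun n => if n is 0 then 0 else n.+2) q.
exists (Ex (Ex (p' ∧ q' ∧ #2 ≐ tApp #1 #0))) => rho y /=.
have e (y0 f x : M) : sat (scons x (scons f (scons y0 rho))) p' = sat (scons f rho) p.
  by rewrite sat_fren; congr sat; apply: funext => -[].
have e' (y0 f x : M) : sat (scons x (scons f (scons y0 rho))) q' = sat (scons x rho) q.
  by rewrite sat_fren; congr sat; apply: funext => -[].
split=> [[f [x []]]|->].
  by rewrite e e' => /Hp -> [/Hq -> ->].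
by exists (F rho), (G rho); rewrite e e'; split; [exact/Hp | split; [exact/Hq|]].
Qed.

Section DefinableGraph.
Variables (A B : term) (k : nat) (F : (nat -> M) -> M).
Hypothesis definable_F : definable F.

Lemma graph_exists rho : exists g,
  graph_spec (eval rho A) (eval rho B) (fun a => F (update rho k a)) g.
Proof.
have [p Hp] := definable_F.
(* Updating the environment at [k] is a renaming that redirects [k] to the index of the argument
   [a]. *)
pose q := fren (fun n => if n is n'.+1 then if n' == k then 1 else n'.+3 else 0) p.
have Hq z a b : sat (scons b (scons a (scons z rho))) q <-> b = F (update rho k a).
  rewrite -Hp /q sat_fren; rewrite (_ : _ \o _ = scons b (update rho k a)) //.
  by apply: funext => -[|n] //=; rewrite /update; case: eqP.
have /= [g Hg] := separation (Ex (Ex (#2 ≐ tPair #1 #0 ∧ q))) rho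
  (prod (eval rho A) (eval rho B)).
exists g => z; rewrite {}Hg mem_prod; split.
  move=> [[a [b [Ha Hb ->]]] [a' [b' [/pair_inj[<- <-] /Hq e]]]].
  by exists a; rewrite -e.
move=> [a [Ha Hb ->]]; split; first by exists a, (F (update rho k a)).
by exists a, (F (update rho k a)); split=> //; apply/Hq.
Qed.

(** Closure of definability under abstraction: the graph exists by separation and is unique by
    extensionality, so its specification defines it. *)
Lemma definable_graph : definable (fun rho =>
  graph (eval rho A) (eval rho B) (fun a => F (update rho k a))).
Proof.
have [p Hp] := definable_F.
pose q := fren (fun n => if n is n'.+1 then if n' == k then 1 else n'.+4 else 0) p.
exists (All (#0 ∈ #1 ⟷ Ex (#0 ∈ tsubst (fun n => #(n.+3)) A ∧
  Ex (#0 ∈ tsubst (fun n => #(n.+4)) B ∧ #2 ≐ tPair #1 #0 ∧ q)))) => rho y.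
have Hq z a b : sat (scons b (scons a (scons z (scons y rho)))) q <-> b = F (update rho k a).
  rewrite -Hp /q sat_fren; rewrite (_ : _ \o _ = scons b (update rho k a)) //.
  by apply: funext => -[|n] //=; rewrite /update; case: eqP.
have Hy : sat (scons y rho) (All (#0 ∈ #1 ⟷ Ex (#0 ∈ tsubst (fun n => #(n.+3)) A ∧
    Ex (#0 ∈ tsubst (fun n => #(n.+4)) B ∧ #2 ≐ tPair #1 #0 ∧ q)))) <->
    graph_spec (eval rho A) (eval rho B) (fun a => F (update rho k a)) y.
  rewrite /=; split=> H z; have [H1 H2] := H z; split.
  - move=> /H1[a [Ha [b [Hb [-> /Hq e]]]]]; exists a.
    by rewrite -e; move: Ha Hb; rewrite !eval_tsubst.
  - move=> [a [Ha Hb ez]]; apply: H2; exists a; rewrite !eval_tsubst; split=> //.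
    by exists (F (update rho k a)); rewrite eval_tsubst; do 2!split=> //; apply/Hq.
  - move=> /H1[a [Ha Hb ->]]; exists a; rewrite eval_tsubst; split=> //.
    by exists (F (update rho k a)); rewrite eval_tsubst; do 2!split=> //; apply/Hq.
  - move=> [a [Ha [b [Hb [ez /Hq e]]]]]; apply: H2; exists a.
    by rewrite -e; split=> //; move: Ha Hb; rewrite !eval_tsubst.
rewrite Hy; have Hg := graphP (graph_exists rho).
by split=> [H|->//]; apply: graph_spec_inj H Hg.
Qed.
End DefinableGraph.

(** The two implications in the definition of equality collapse to one equivalence because [top] and
    [bot] are the only Booleans and differ. *)
Definition eqf_at (A x f : M) : Prop := f \in' arr A boolset /\
  forall y b, pair y b \in' f <->
    [/\ y \in' A, b \in' boolset & b = top <-> x = y].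

Lemma mem_eqf (A z : M) : z \in' eqf A <->
  exists x f, [/\ z = pair x f, x \in' A & eqf_at A x f].
Proof.
have /= [H1 H2] := HM (or_intror def_eqf) rho0 A z.
split=> [/H1[x [f [-> [Hx [Hf H]]]]]|[x [f [ez Hx [Hf H]]]]].
  exists x, f; split=> //; split=> // y b; have [H3 H4] := H (pair y b); split.
    move=> /H3[y' [b' [/pair_inj[<- <-] [Hy [Hb [e1 e2]]]]]]; split=> //.
    split=> // e; apply: contrapT => /e2; rewrite e; exact: top_neq_bot.
  move=> [Hy Hb e]; apply: H4; exists y, b.
  refine (conj erefl (conj Hy (conj Hb (conj _ _)))); first by case: e.
  by move=> n; have /mem_bool[//|/e /n] := Hb.
apply: H2; exists x, f; refine (conj ez (conj Hx (conj Hf _))) => w; split.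
  move=> Hw; have /mem_prod[y [b [_ _ e]]] := ((mem_arr A boolset f).1 Hf).1 w Hw.
  move: Hw; rewrite e => /H[Hy Hb eb]; exists y, b.
  refine (conj erefl (conj Hy (conj Hb (conj _ _)))); first by case: eb.
  by move=> n; have /mem_bool[//|/eb /n] := Hb.
move=> [y [b [-> [Hy [Hb [e1 e2]]]]]]; apply/H; split=> //; split=> // e.
by apply: contrapT => /e2; rewrite e; exact: top_neq_bot.
Qed.

Lemma eqf_at_exists (A x : M) : exists f, eqf_at A x f.
Proof.
have /= [f Hf] := separation (Ex (Ex (#2 ≐ tPair #1 #0 ∧ (#0 ≐ tTop ⟷ #3 ≐ #1))))
  (scons x rho0) (prod A boolset).
have Hp y b : pair y b \in' f <-> [/\ y \in' A, b \in' boolset & b = top <-> x = y].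
  rewrite Hf mem_prod; split.
    move=> [[y' [b' [Hy Hb /pair_inj[-> ->]]]] [y2 [b2 [/pair_inj[<- <-] [e1 e2]]]]].
    by split.
  move=> [Hy Hb [e1 e2]]; split; first by exists y, b.
  by exists y, b.
exists f; split=> //; apply/mem_arr; split=> [z /Hf[] //|y Hy].
have [e|ne] := EM (x = y).
  exists top; split; first by apply/Hp; split=> //; apply: top_in_bool.
  by move=> b' /Hp[_ _ H]; apply/H.
exists bot; split.
  apply/Hp; split=> //; first by apply/mem_bool; left.
  by split=> // /esym/top_neq_bot.
by move=> b' /Hp[_ /mem_bool[//|e] H]; move: (ne (H.1 e)).
Qed.

Lemma eqf_at_inj (A x f g : M) : eqf_at A x f -> eqf_at A x g -> f = g.
Proof.
move=> [Hf H] [Hg H']; apply: (arr_ext Hf Hg) => y Hy; symmetry.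
by apply: (pair_app Hg); apply/H'/H; apply: app_pair Hf Hy.
Qed.

Lemma eqf_in_arr (A : M) : eqf A \in' arr A (arr A boolset).
Proof.
apply/mem_arr; split=> [z /mem_eqf[x [f [-> Hx [Hf _]]]]|x Hx].
  by apply/mem_prod; exists x, f.
have [f Hf] := eqf_at_exists A x; exists f; split.
  by apply/mem_eqf; exists x, f.
move=> g /mem_eqf[x' [f' [/pair_inj[ex ->] _ Hf']]]; rewrite -ex in Hf'.
exact: eqf_at_inj Hf' Hf.
Qed.

Lemma app_eqf (A x y : M) : x \in' A -> y \in' A ->
  app (app (eqf A) x) y = top <-> x = y.
Proof.
move=> Hx Hy; have /mem_eqf[x' [f [/pair_inj[ex ->] _ [Hf H]]]] := app_pair (eqf_in_arr A) Hx.
by have /H[_ _] := app_pair Hf Hy; rewrite -ex.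
Qed.

(** * Denotations of HOL terms *)

Fixpoint dty (tau : nat -> M) (A : ty) : M :=
  match A with
  | TyVar X => tau X
  | TyBool => boolset
  | TyInd => sop0 M SNat
  | TyArr A B => arr (dty tau A) (dty tau B)
  end.

Fixpoint den (tau : nat -> M) (v : hvar -> M) (t : tm) : M :=
  match t with
  | HVar x => v x
  | HEq A => eqf (dty tau A)
  | HApp f a => app (den tau v f) (den tau v a)
  | HLam x t =>
      graph (dty tau x.2) (dty tau (tyof t)) (fun a => den tau (update v x a) t)
  end.

Definition tyenv_of (nu : naming) (rho : nat -> M) (X : nat) : M := rho (nu (SymTy X)).
Definition varenv_of (nu : naming) (rho : nat -> M) (x : hvar) : M := rho (nu (SymVar x)).

(** Assembles an environment from assignments to the three kinds of names. Injectivity of the naming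
    makes the preimage of an index unique; indices that name nothing get the empty set. *)
Definition env_of (nu : naming) (tau : nat -> M) (v : hvar -> M)
    (l : hvar -> tm -> M) (n : nat) : M :=
  if pselect (exists h, fo nu h = n) is left e then
    match projT1 (cid e) with
    | SymTy X => tau X
    | SymVar x => v x
    | SymLam x t => l x t
    end
  else empty.

Section Naming.
Variable nu : naming.
Local Notation tyenv := (tyenv_of nu).
Local Notation varenv := (varenv_of nu).
Local Notation env := (env_of nu).

Lemma envE tau v l h : env tau v l (nu h) =
  match h with SymTy X => tau X | SymVar x => v x | SymLam x t => l x t end.
Proof.
rewrite /env_of; case: pselect => [e|]; last by case; exists h.
by case: cid => h' /= /(@fo_inj nu) ->.
Qed.

Lemma tyenv_env tau v l : tyenv (env tau v l) = tau.
Proof. by apply: funext => X; rewrite /tyenv_of envE. Qed.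

Lemma varenv_env tau v l : varenv (env tau v l) = v.
Proof. by apply: funext => x; rewrite /varenv_of envE. Qed.

Lemma tyenv_update rho x a : tyenv (update rho (nu (SymVar x)) a) = tyenv rho.
Proof.
apply: funext => X; rewrite /tyenv_of /update ifN //.
by apply/eqP => /(@fo_inj nu).
Qed.

Lemma varenv_update rho x a :
  varenv (update rho (nu (SymVar x)) a) = update (varenv rho) x a.
Proof.
apply: funext => y; rewrite /varenv_of /update.
by have -> : (nu (SymVar y) == nu (SymVar x)) = (y == x) by apply/eqP/eqP => [/(@fo_inj nu)[]|->].
Qed.

Lemma eval_emb_ty rho A : eval rho (emb_ty nu A) = dty (tyenv rho) A.
Proof. by elim: A => //= A -> B ->. Qed.

(** Lets separation form the graph of an abstraction inside [M]: type and term variables become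
    parameters of a formula, read off through the naming. *)
Lemma definable_den t : definable (fun rho => den (tyenv rho) (varenv rho) t).
Proof.
elim: t => [x|A|f IHf a IHa|x t IHt] /=.
- exact: definable_term (emb_var nu x).
- have [p Hp] := definable_term (tEqf (emb_ty nu A)).
  by exists p => rho y; rewrite Hp /= eval_emb_ty.
- exact: definable_app.
- have [p Hp] := definable_graph (emb_ty nu x.2) (emb_ty nu (tyof t)) (nu (SymVar x)) IHt.
  exists p => rho y; rewrite Hp !eval_emb_ty.
  rewrite (_ : (fun a => _) = fun a => den (tyenv rho) (update (varenv rho) x a) t) //.
  by apply: funext => a; rewrite tyenv_update varenv_update.
Qed.

End Naming.

(** No naming is involved in the claim; the default one serves to realise [tau] and [v] by an
    environment to which definability applies. *)
Lemma den_graph_spec tau v x t :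
  graph_spec (dty tau x.2) (dty tau (tyof t)) (fun a => den tau (update v x a) t)
    (den tau v (HLam x t)).
Proof.
apply: graphP; have [g] := graph_exists (emb_ty naming_default x.2)
  (emb_ty naming_default (tyof t)) (naming_default (SymVar x))
  (definable_den naming_default t) (env_of naming_default tau v (fun _ _ => empty)).
rewrite !eval_emb_ty !tyenv_env => Hg; exists g => z; rewrite Hg.
by split=> -[a Ha]; exists a; move: Ha; rewrite tyenv_update varenv_update tyenv_env varenv_env.
Qed.

Definition typed (tau : nat -> M) (v : hvar -> M) (x : hvar) : Prop :=
  v x \in' dty tau x.2.

Lemma typed_update tau v x a y : a \in' dty tau x.2 ->
  (y != x -> typed tau v y) -> typed tau (update v x a) y.
Proof. by rewrite /typed /update; case: (y =P x) => [->|_] // _; apply. Qed.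

Lemma den_typed tau v t : wt t -> (forall x, x \in fv t -> typed tau v x) ->
  den tau v t \in' dty tau (tyof t).
Proof.
elim: t v => [x|A|f IHf a IHa|x t IHt] v /=.
- by move=> _; apply; rewrite mem_head.
- by move=> _ _; apply: eqf_in_arr.
- case/and3P => /IHf{}IHf /IHa{}IHa + H.
  have {}IHf : den tau v f \in' dty tau (tyof f).
    by apply: IHf => x Hx; apply: H; rewrite mem_undup mem_cat Hx.
  have {}IHa : den tau v a \in' dty tau (tyof a).
    by apply: IHa => x Hx; apply: H; rewrite mem_undup mem_cat Hx orbT.
  case: (tyof f) IHf => //= A B IHf /eqP e; rewrite e in IHa.
  exact: app_in IHf IHa.
- move=> Ht H; apply: graph_in_arr (den_graph_spec tau v x t) _ => a Ha.
  apply: IHt => // y Hy; apply: typed_update => // yx; apply: H.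
  by rewrite mem_filter yx.
Qed.

Lemma den_beta tau v x t a : wt t -> (forall y, y \in fv (HLam x t) -> typed tau v y) ->
  a \in' dty tau x.2 -> app (den tau v (HLam x t)) a = den tau (update v x a) t.
Proof.
move=> Ht H; apply: graph_app (den_graph_spec tau v x t) _ => b Hb.
apply: den_typed => // y Hy; apply: typed_update => // yx; apply: H.
by rewrite mem_filter yx.
Qed.

Lemma eq_dty tau tau' A : {in ty_tyvars A, tau =1 tau'} -> dty tau A = dty tau' A.
Proof.
elim: A => //= [X|A IHA B IHB] H; first by rewrite H ?mem_head.
by rewrite IHA ?IHB // => X HX; apply: H; rewrite mem_cat HX ?orbT.
Qed.

(** Well-typedness serves for the codomain of an abstraction: the type variables in the type of its
    body then occur in the body. *)
Lemma eq_den tau tau' v v' t : wt t ->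
  {in tyvars t, tau =1 tau'} -> {in fv t, v =1 v'} -> den tau v t = den tau' v' t.
Proof.
elim: t v v' => [x|A|f IHf a IHa|x t IHt] v v' /=.
- by move=> _ _; apply; rewrite mem_head.
- by move=> _ H _; rewrite (eq_dty H).
- move=> /and3P[wf wa _] Ht Hv.
  by rewrite (IHf v v') ?(IHa v v') // => y Hy; first [apply: Ht|apply: Hv];
    rewrite ?mem_undup mem_cat Hy ?orbT.
- move=> wt_t Ht Hv.
  rewrite (@eq_dty tau tau' x.2); last by move=> X HX; apply: Ht; rewrite mem_cat HX.
  have Ht' : {in tyvars t, tau =1 tau'} by move=> X HX; apply: Ht; rewrite mem_cat HX orbT.
  rewrite (@eq_dty tau tau' (tyof t)); last by move=> X /(tyvars_tyof wt_t)/Ht'.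
  apply: eq_graph => a _; apply: IHt => // y Hy; rewrite /update; case: eqP => // /eqP yx.
  by apply: Hv; rewrite mem_filter yx.
Qed.

Lemma dty_nonempty tau A : (forall X, exists a, a \in' tau X) -> exists a, a \in' dty tau A.
Proof.
move=> H; elim: A => //= [||A _ B [b Hb]].
- by exists top; apply: top_in_bool.
- by exists empty; apply: empty_in_nat.
(* A constant function, as the denotation of an abstraction whose body is a variable with value [b].
   If [A] and [B] coincide then so do the two variables, and the term is the identity instead. *)
- exists (den tau (fun _ => b) (HLam (0, A) (HVar (0, B)))).
  apply: (@den_typed tau (fun _ => b) (HLam (0, A) (HVar (0, B)))) => //= x.
  by case: ifP => // _; rewrite inE => /eqP ->.
Qed.

(** * Embedded terms evaluate to denotations *)

Variable nu : naming.
Local Notation tyenv := (tyenv_of nu).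
Local Notation varenv := (varenv_of nu).
Local Notation env := (env_of nu).

Lemma sat_typing (rho : nat -> M) x : sat rho (typing nu x) <-> typed (tyenv rho) (varenv rho) x.
Proof. by rewrite /typing /= eval_emb_ty. Qed.

Lemma sat_ctxT (rho : nat -> M) t : all_true (sat rho) (ctxT nu t) <->
  forall x, x \in fv t -> typed (tyenv rho) (varenv rho) x.
Proof.
split=> [H x Hx|H p Hp].
  by apply/sat_typing/H/mem_ctxT; exists x.
by have /mem_ctxT[x Hx ->] := Hp; apply/sat_typing/H.
Qed.

Lemma all_true_cat (V : form -> Prop) G D :
  all_true V (G ++ D) <-> all_true V G /\ all_true V D.
Proof.
split=> [H|[HG HD] p]; last by rewrite mem_cat => /orP[/HG|/HD].
by split=> p Hp; apply: H; rewrite mem_cat Hp ?orbT.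
Qed.

Lemma eval_apps (rho : nat -> M) f xs : eval rho (apps f xs) = foldl app (eval rho f) (map (eval rho) xs).
Proof. by elim: xs f => //= x xs IH f; rewrite IH. Qed.

(* Agreement on all names except those of HOL variables outside [xs]. *)
Definition agree (xs : seq hvar) (rho rho' : nat -> M) : Prop :=
  forall n, (forall x, nu (SymVar x) = n -> x \in xs) -> rho n = rho' n.

Lemma agree_ty xs rho rho' X : agree xs rho rho' ->
  rho (nu (SymTy X)) = rho' (nu (SymTy X)).
Proof. by apply=> x /(@fo_inj nu). Qed.

Lemma agree_lam xs rho rho' x t : agree xs rho rho' ->
  rho (nu (SymLam x t)) = rho' (nu (SymLam x t)).
Proof. by apply=> y /(@fo_inj nu). Qed.

Lemma agree_var xs rho rho' x : agree xs rho rho' -> x \in xs ->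
  rho (nu (SymVar x)) = rho' (nu (SymVar x)).
Proof. by move=> H Hx; apply: H => y /(@fo_inj nu)[->]. Qed.

Lemma agree_tyenv xs rho rho' : agree xs rho rho' -> tyenv rho = tyenv rho'.
Proof. by move=> H; apply: funext => X; apply: agree_ty H. Qed.

Lemma agree_update rho x a : agree [::] rho (update rho (nu (SymVar x)) a).
Proof. by move=> n H; rewrite /update; case: eqP => // e; have := H x (esym e). Qed.

(** An abstraction is embedded as its reserved variable applied to its free variables, so bound
    variables are never read. *)
Lemma agree_eval_emb rho rho' t : agree (fv t) rho rho' ->
  eval rho (emb nu t) = eval rho' (emb nu t).
Proof.
elim: t => [x|A|f IHf a IHa|x t _] /= H.
- by apply: agree_var H _; rewrite mem_head.
- by rewrite !eval_emb_ty (agree_tyenv H).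
- by rewrite IHf ?IHa // => n Hn; apply: H => x /Hn;
    rewrite mem_undup mem_cat => ->; rewrite ?orbT.
- rewrite !eval_apps /= (agree_lam _ _ H) -!map_comp; congr foldl.
  by apply/eq_in_map => y Hy /=; apply: agree_var H Hy.
Qed.

Lemma sat_all_var (rho : nat -> M) k p : sat rho (all_var k p) = (forall a, sat (update rho k a) p).
Proof.
rewrite /all_var /fren /=; apply: eq_forall => a; rewrite sat_fsubst; congr sat.
apply: funext => n /=.
by rewrite /update; case: eqP.
Qed.

(** Types may be evaluated in [rho] throughout, since updating HOL variables leaves type variables
    alone; this turns the nested quantifiers into a single one over environments. *)
Lemma sat_foldr_all_in (rho : nat -> M) ys p :
  sat rho (foldr (fun y q => all_in (nu (SymVar y)) (emb_ty nu y.2) q) p ys) <->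
  forall rho', (forall n, (forall y, y \in ys -> nu (SymVar y) <> n) -> rho' n = rho n) ->
    (forall y, y \in ys -> typed (tyenv rho) (varenv rho') y) -> sat rho' p.
Proof.
elim: ys rho => [|y ys IH] rho.
  split=> [/= H rho' e _|]; last by apply.
  by rewrite (_ : rho' = rho) //; apply: funext => n; apply: e.
rewrite [foldr _ _ _]/= /all_in sat_all_var /=; split=> [H rho' Hr Ht|H a Ha].
  have := H (varenv rho' y); rewrite eval_emb_ty tyenv_update.
  move=> /(_ _)/IH; apply.
  - by rewrite /update eqxx; apply: Ht; rewrite mem_head.
  - move=> n Hn; rewrite /update; case: eqP => [->//|ne]; apply: Hr => z.
    by rewrite in_cons => /predU1P[-> /esym|/Hn].
  - by move=> z Hz; rewrite tyenv_update; apply: Ht; rewrite in_cons Hz orbT.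
move: Ha; rewrite eval_emb_ty tyenv_update => Ha.
apply/IH => rho' Hr; rewrite tyenv_update => Ht; apply: H.
  move=> n Hn; rewrite Hr /update; last first.
    by move=> z Hz; apply: Hn; rewrite in_cons Hz orbT.
  by case: eqP => // e; have := Hn y (mem_head _ _) (esym e).
move=> z; have [Hz _|Hz] := boolP (z \in ys); first exact: Ht.
rewrite in_cons (negbTE Hz) orbF => /eqP ->; rewrite /typed.
move: Ha; rewrite {1}/update eqxx.
have [/Ht //|ny] := boolP (y \in ys).
rewrite /varenv_of Hr ?{1}/update ?eqxx // => u Hu /(@fo_inj nu)[e].
by rewrite -e Hu in ny.
Qed.

Lemma fv_HLam_cover x t y : y \in fv t -> y \in rcons (fv (HLam x t)) x.
Proof. by rewrite mem_rcons in_cons /= mem_filter => ->; rewrite andbT orbN. Qed.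

(* [lam_def] has no free HOL variables: it quantifies over those of the abstraction. *)
Lemma agree_lam_def rho rho' x t : agree [::] rho rho' ->
  sat rho (lam_def nu x t) -> sat rho' (lam_def nu x t).
Proof.
set ys := rcons (fv (HLam x t)) x => H [Hty Hall]; split.
  move: Hty; rewrite /= -(agree_lam _ _ H); congr smem.
  by elim: (rcons _ _) => [|y ys' IH] /=; rewrite ?IH !eval_emb_ty (agree_tyenv H).
apply/sat_foldr_all_in => rho1' Hr1 Ht1.
move/sat_foldr_all_in: Hall; rewrite -/ys.
(* Carries [rho1'] back over [rho]: the quantified variables keep their values from [rho1'],
   everything else is as in [rho]. *)
pose rho1 n := if n \in [seq nu (SymVar y) | y <- ys] then rho1' n else rho n.
have Hagree : agree ys rho1 rho1'.
  move=> n Hn; rewrite /rho1; case: ifP => // /negbT nn.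
  rewrite Hr1 => [|y Hy e]; last by move/negP: nn; apply; rewrite -e map_f.
  apply: H => z e; have Hz := Hn z e.
  by move/negP: nn; case; rewrite -e map_f.
have Hvar y : y \in ys -> varenv rho1 y = varenv rho1' y by move=> Hy; apply: agree_var Hagree Hy.
move=> /(_ rho1); rewrite /= !eval_apps => E.
have -> : eval rho1' (emb nu t) = eval rho1 (emb nu t).
  symmetry; apply: agree_eval_emb => n Hn; apply: Hagree => y /Hn.
  exact: fv_HLam_cover.
rewrite -[RHS]E.
- congr foldl; first by rewrite /= (agree_lam _ _ Hagree).
  rewrite -!map_comp; apply/eq_in_map => y Hy /=.
  by symmetry; apply: Hvar.
- move=> n Hn; rewrite /rho1; case: ifP => // /mapP[y Hy e].
  by case: (Hn y Hy).
- by move=> y Hy; rewrite /typed Hvar // (agree_tyenv H); apply: Ht1.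
Qed.

Lemma agree_ctxD rho rho' t : agree [::] rho rho' ->
  all_true (sat rho) (ctxD nu t) -> all_true (sat rho') (ctxD nu t).
Proof.
move=> H; elim: t => [x|A|f IHf a IHa|x t IHt] //=.
  by rewrite !all_true_cat => -[/IHf ? /IHa].
rewrite !all_true_cat !true_consE => -[/IHt ? [Hl _]]; split=> //; split=> //.
exact: agree_lam_def H Hl.
Qed.

Lemma off_agree (ys : seq hvar) (rho rho' : nat -> M) :
  (forall n, (forall y, y \in ys -> nu (SymVar y) <> n) -> rho' n = rho n) ->
  agree [::] rho rho'.
Proof. by move=> H n Hn; rewrite H // => y _ /Hn. Qed.

Lemma sat_lam_def (rho : nat -> M) x t : sat rho (lam_def nu x t) <->
  rho (nu (SymLam x t)) \in'
    dty (tyenv rho) (foldr (fun y B => TyArr y.2 B) (tyof t) (rcons (fv (HLam x t)) x)) /\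
  forall rho', (forall n, (forall y, y \in rcons (fv (HLam x t)) x -> nu (SymVar y) <> n) ->
      rho' n = rho n) ->
    (forall y, y \in rcons (fv (HLam x t)) x -> typed (tyenv rho) (varenv rho') y) ->
    foldl app (rho (nu (SymLam x t))) (map (varenv rho') (rcons (fv (HLam x t)) x)) =
    eval rho' (emb nu t).
Proof.
rewrite /lam_def; set ys := rcons _ _.
have e1 : eval rho (foldr (fun y B => tArr (emb_ty nu y.2) B) (emb_ty nu (tyof t)) ys) =
    dty (tyenv rho) (foldr (fun y B => TyArr y.2 B) (tyof t) ys).
  by elim: ys => [|y ys' IH] /=; rewrite ?IH eval_emb_ty.
have e2 rho' : (forall n, (forall y, y \in ys -> nu (SymVar y) <> n) -> rho' n = rho n) ->
    sat rho' (apps #(nu (SymLam x t)) (map (emb_var nu) ys) ≐ emb nu t) <->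
    foldl app (rho (nu (SymLam x t))) (map (varenv rho') ys) = eval rho' (emb nu t).
  move=> /off_agree/(agree_lam x t) e.
  by rewrite [X in X <-> _]/= eval_apps -map_comp e.
rewrite -e1; split=> -[H1 /= H2]; split=> //.
  by move/sat_foldr_all_in: H2 => H2 rho' Hr Ht; apply/e2 => //; apply: H2.
by apply/sat_foldr_all_in => rho' Hr Ht; apply/e2 => //; apply: H2.
Qed.

(** In the abstraction case both sides are functions between the same sets and are compared
    pointwise. At [a] the defining formula yields the embedded body in the environment with [x] set
    to [a]; the induction hypothesis applies there because [ctxD] does not depend on the values of
    HOL variables. *)
Theorem eval_emb rho t : wt t ->
  all_true (sat rho) (ctxT nu t) -> all_true (sat rho) (ctxD nu t) ->
  eval rho (emb nu t) = den (tyenv rho) (varenv rho) t.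
Proof.
elim: t rho => [x|A|f IHf a IHa|x t IHt] rho.
- by [].
- by rewrite /= eval_emb_ty.
- rewrite /= => /and3P[wf wa _] /all_true_cat[Tf Ta] /all_true_cat[Df Da].
  by rewrite IHf ?IHa.
move=> wt_t /sat_ctxT HT; rewrite [ctxD _ _]/= all_true_cat !true_consE.
move=> [HD [/sat_lam_def[Hlam1 Hlam2] _]]; set lam := rho (nu (SymLam x t)).
rewrite [emb _ _]/= eval_apps -map_comp -[map _ _]/(map (varenv rho) (fv (HLam x t))).
apply: (@arr_ext (dty (tyenv rho) x.2) (dty (tyenv rho) (tyof t))).
(* The reserved variable lies in an iterated function space; applying it to the well-typed free
   variables peels this down to the type of the abstraction. *)
- move: Hlam1 HT; rewrite [eval rho _]/= -/lam; elim: (fv _) (lam) => [|y ys IH] //= l Hl HT.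
  apply: IH; last by move=> z Hz; apply: HT; rewrite in_cons Hz orbT.
  by apply: app_in Hl _; apply: HT; rewrite mem_head.
- exact: (@den_typed _ _ (HLam x t)).
move=> a Ha; rewrite den_beta //.
pose rho' := update rho (nu (SymVar x)) a.
have Ht' y : y \in rcons (fv (HLam x t)) x -> typed (tyenv rho) (varenv rho') y.
  rewrite varenv_update mem_rcons in_cons => Hy.
  by apply: typed_update => // yx; move: Hy; rewrite (negbTE yx); apply: HT.
have -> : den (tyenv rho) (update (varenv rho) x a) t = eval rho' (emb nu t).
  rewrite -varenv_update -(tyenv_update nu rho x a); symmetry; apply: IHt => //.
    by apply/sat_ctxT => y /(fv_HLam_cover x); rewrite tyenv_update; apply: Ht'.
  exact: agree_ctxD (agree_update _ _ _) HD.
rewrite -Hlam2 //; last first.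
  move=> n Hn; rewrite /rho' /update; case: eqP => // e.
  by case: (Hn x); rewrite // mem_rcons mem_head.
rewrite map_rcons foldl_rcons /=; congr (app (foldl _ _ _) _).
  apply/eq_in_map => y; rewrite /= mem_filter => /andP[yx _].
  by rewrite varenv_update /update (negbTE yx).
by rewrite varenv_update /update eqxx.
Qed.

(** * Canonical environments and validity of HOL sequents *)

Definition canonical (tau : nat -> M) (v : hvar -> M) : nat -> M :=
  env tau v (fun x t => den tau v (foldr HLam t (rcons (fv (HLam x t)) x))).

Lemma fv_foldr_HLam t ys y : y \in fv (foldr HLam t ys) -> y \in fv t /\ y \notin ys.
Proof.
elim: ys => //= z ys IH; rewrite mem_filter in_cons => /andP[yz /IH[-> ny]].
by rewrite negb_or yz.
Qed.

Lemma wt_foldr_HLam t ys : wt (foldr HLam t ys) = wt t.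
Proof. by elim: ys. Qed.

(** Each beta step sets a variable to the value it already has, so the assignment never changes. *)
Lemma den_foldr_HLam tau v t ys : wt t -> (forall y, typed tau v y) ->
  foldl app (den tau v (foldr HLam t ys)) (map v ys) = den tau v t.
Proof.
move=> wt_t Hv; elim: ys => //= y ys IH.
rewrite (@den_beta tau v y (foldr HLam t ys)) ?wt_foldr_HLam //; last exact: Hv.
rewrite (_ : update v y (v y) = v) //.
by apply: funext => z; rewrite /update; case: eqP => [->|].
Qed.

Lemma canonical_ctxD tau v t : (forall x, typed tau v x) -> wt t ->
  all_true (sat (canonical tau v)) (ctxD nu t).
Proof.
move=> Hv; elim: t => [x|A|f IHf a IHa|x t IHt] //=.
  by move=> /and3P[/IHf Hf /IHa Ha _]; apply/all_true_cat.
move=> wt_t; rewrite all_true_cat !true_consE; split; first exact: IHt.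
split=> //; apply/sat_lam_def; rewrite tyenv_env [canonical _ _ _]envE.
set ys := rcons _ _; split.
  have -> : foldr (fun y B => TyArr y.2 B) (tyof t) ys = tyof (foldr HLam t ys).
    by elim: ys => //= y ys ->.
  by apply: den_typed; rewrite ?wt_foldr_HLam.
move=> rho' Hr Ht; have Hagree := off_agree Hr.
have tyE : tyenv rho' = tau by rewrite -(agree_tyenv Hagree) tyenv_env.
rewrite eval_emb //; last first.
- exact: agree_ctxD Hagree (IHt _).
- by apply/sat_ctxT => y /(fv_HLam_cover x); rewrite tyE; apply: Ht.
rewrite tyE -(@den_foldr_HLam tau (varenv rho') t ys) //; last first.
  move=> y; have [/Ht //|ny] := boolP (y \in ys).
  rewrite /typed /varenv_of Hr; first by rewrite [canonical _ _ _]envE; apply: Hv.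
  by move=> z Hz /(@fo_inj nu)[e]; rewrite -e Hz in ny.
(* The closure has no free variables, so its value under [v] is also its value under the assignment
   of [rho']. *)
congr foldl; apply: eq_den; rewrite ?wt_foldr_HLam //.
move=> y /fv_foldr_HLam[/(fv_HLam_cover x)]; rewrite -/ys => -> //.
Qed.

(** Assignments are total and well typed also on names foreign to the sequent, so that premises with
    additional variables can be used at the same assignment. *)
Definition valid (s : hsequent) : Prop :=
  forall tau v, (forall X, exists a, a \in' tau X) -> (forall x, typed tau v x) ->
  (forall h, h \in hyps s -> den tau v h = top) -> den tau v (concl s) = top.

Lemma sat_canonical_ctx tau v t : (forall X, exists a, a \in' tau X) ->
  (forall x, typed tau v x) -> wt t -> all_true (sat (canonical tau v)) (ctx nu t).
Proof.
move=> Htau Hv wt_t; rewrite /ctx !all_true_cat; split; last split.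
- move=> _ /mapP[X _ ->] /=; rewrite [canonical _ _ _]envE => e.
  by have [a] := Htau X; rewrite e; apply: mem_empty.
- by apply/sat_ctxT => x _; rewrite tyenv_env varenv_env.
- exact: canonical_ctxD.
Qed.

Lemma eval_canonical tau v t : (forall X, exists a, a \in' tau X) ->
  (forall x, typed tau v x) -> wt t ->
  eval (canonical tau v) (emb nu t) = den tau v t.
Proof.
move=> Htau Hv wt_t; have := sat_canonical_ctx Htau Hv wt_t.
by rewrite /ctx !all_true_cat => -[_ [HT HD]]; rewrite eval_emb // tyenv_env varenv_env.
Qed.

Lemma provable_valid s : wf_sequent s -> emb_provable nu s -> valid s.
Proof.
move=> /allP wf prov tau v Htau Hv Hh.
have wt_s t : t \in concl s :: hyps s -> wt t by case/wf/andP.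
rewrite -eval_canonical //; last by apply: wt_s; rewrite mem_head.
have := soundness (rho := canonical tau v) HM prov.
rewrite !true_consE => H; suff /H[] : all_true (sat (canonical tau v))
  (flatten (map (ctx nu) (hyps s)) ++ ctx nu (concl s) ++
     [seq emb nu t ≐ tTop | t <- hyps s]) by [].
apply/all_true_cat; split; last (apply/all_true_cat; split).
- move=> p /flattenP[_ /mapP[t Ht ->]]; apply: sat_canonical_ctx => //.
  by apply: wt_s; rewrite in_cons Ht orbT.
- by apply: sat_canonical_ctx => //; apply: wt_s; rewrite mem_head.
- move=> _ /mapP[t Ht ->] /=; rewrite eval_canonical ?Hh //.
  by apply: wt_s; rewrite in_cons Ht orbT.
Qed.

(** The context of a term constrains only the names that occur in it. Type variables that denote a
    set without elements are reset to an inhabited one, here the Booleans. *)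
Definition inhabited_tyenv (rho : nat -> M) (X : nat) : M :=
  if pselect (exists a, a \in' tyenv rho X) then tyenv rho X else boolset.

Lemma inhabited_tyenvP rho X : exists a, a \in' inhabited_tyenv rho X.
Proof.
rewrite /inhabited_tyenv; case: pselect => [//|n] /=.
by exists top; apply: top_in_bool.
Qed.

(** The same repair for term variables: an ill-typed value gives way to a chosen element of the
    type. *)
Definition typed_varenv (rho : nat -> M) (x : hvar) : M :=
  if pselect (varenv rho x \in' dty (inhabited_tyenv rho) x.2) then varenv rho x
  else projT1 (cid (dty_nonempty x.2 (inhabited_tyenvP rho))).

Lemma typed_varenvP rho x : typed (inhabited_tyenv rho) (typed_varenv rho) x.
Proof. by rewrite /typed /typed_varenv; case: pselect => [//|n] /=; case: cid. Qed.

(** On the names of [t] the repair changes nothing, by the nonemptiness and typing formulas in its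
    context. *)
Lemma eval_emb_inhabited rho t : wt t -> all_true (sat rho) (ctx nu t) ->
  eval rho (emb nu t) = den (inhabited_tyenv rho) (typed_varenv rho) t.
Proof.
move=> wt_t; rewrite /ctx !all_true_cat => -[HN [HT HD]]; rewrite eval_emb //.
have Hty X : X \in tyvars t -> tyenv rho X = inhabited_tyenv rho X.
  move=> HX; rewrite /inhabited_tyenv; case: pselect => // n.
  have /= [] := HN _ (map_f _ HX).
  apply: extensionality => z; split=> [Hz|/mem_empty //].
  by case: n; exists z.
apply: eq_den => // x Hx; rewrite /typed_varenv; case: pselect => // -[].
rewrite -(@eq_dty (tyenv rho)); first by move/sat_ctxT: HT; apply.
by move=> X HX; apply: Hty; apply: fv_tyvars Hx _ HX.
Qed.
End Model.

Theorem emb_provableP nu s : wf_sequent s ->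
  emb_provable nu s <-> forall M, FOST_model M -> @valid M s.
Proof.
move=> wf; split=> [H M HM|H]; first exact: (provable_valid HM wf H).
apply: completeness => M HM rho /all_true_cat[Hh /all_true_cat[Hc He]].
move/allP: wf => wf.
have wt_s t : t \in concl s :: hyps s -> wt t by case/wf/andP.
rewrite !true_consE; left => /=.
rewrite (eval_emb_inhabited HM _ Hc); last by apply: wt_s; rewrite mem_head.
apply: (H M HM) => [X|x|t Ht].
- exact: inhabited_tyenvP.
- exact: typed_varenvP.
rewrite -(eval_emb_inhabited HM).
- exact: He (map_f _ Ht).
- by apply: wt_s; rewrite in_cons Ht orbT.
- by move=> p Hp; apply: Hh; apply/flattenP; exists (ctx nu t) => //; apply: map_f.
Qed.

(** * Soundness of the HOL rules *)

Lemma wt_heq A s t : wt (heq A s t) = [&& wt s, tyof s == A, wt t & tyof t == A].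
Proof. by rewrite /= -!andbA. Qed.

Lemma ty_subst_var A : ty_subst TyVar A = A.
Proof. by elim: A => //= A -> B ->. Qed.

Lemma variant_fresh avoid x : variant avoid x \notin avoid.
Proof.
rewrite /variant; case: ifP => [_|->] //; apply/negP => H.
suff : (\max_(y <- avoid) y.1).+1 <= \max_(y <- avoid) y.1 by rewrite ltnn.
by rewrite [leqRHS](big_rem _ H) leq_maxl.
Qed.

Lemma variant_type avoid x : (variant avoid x).2 = x.2.
Proof. by rewrite /variant; case: ifP. Qed.

Lemma assoc_in (K V : eqType) (l : seq (K * V)) k v : assoc l k = Some v -> (k, v) \in l.
Proof.
elim: l => //= -[k' v'] l IH; rewrite in_cons; case: eqP => [-> [->]|_ /IH ->].
  by rewrite eqxx.
by rewrite orbT.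
Qed.

Lemma alpha_tyof e s t : all (fun p => p.1.2 == p.2.2) e -> alpha_in e s t -> tyof s = tyof t.
Proof.
elim: s t e => [x|A|f IHf a IHa|x s IHs] [y|B|g b|y t] //= e He.
- elim: e He => [_ /eqP -> //|[a b] e IH] /= /andP[/eqP ab /IH{}IH].
  by case: eqP => [-> /eqP -> //|_ /andP[_ /IH]].
- by move/eqP ->.
- by case/andP => /(IHf _ _ He) ->.
- by case/andP => /eqP xy /(IHs t ((x, y) :: e)) -> //=; rewrite ?xy ?eqxx.
Qed.

Lemma tyof_subst r s t : wt t ->
  (forall x, x \in fv t -> tyof (s x) = ty_subst r x.2) ->
  tyof (tm_subst r s t) = ty_subst r (tyof t).
Proof.
elim: t s => [x|A|f IHf a IHa|x t IHt] s //=.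
- by move=> _; apply; rewrite mem_head.
- move=> /and3P[wf _ +] H; rewrite (IHf s wf); first by case: (tyof f).
  by move=> x Hx; apply: H; rewrite mem_undup mem_cat Hx.
- move=> wt_t H; rewrite variant_type (IHt _ wt_t) // => y Hy.
  case: eqP => [->|/eqP yx] /=; first by rewrite variant_type.
  by apply: H; rewrite mem_filter yx.
Qed.

Section Rules.
Variable M : structure.
Hypothesis HM : FOST_model M.
Implicit Types (tau : nat -> M) (v : hvar -> M).

Local Notation "a \in' b" := (@smem M a b) (at level 70, no associativity).
Local Notation top := (sop0 M STop).

Lemma den_in tau v t A : (forall x, typed tau v x) -> wt t -> tyof t = A ->
  den tau v t \in' dty tau A.
Proof. by move=> Hv wt_t <-; apply: (den_typed HM) => // x _; apply: Hv. Qed.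

Lemma den_heq tau v A s t : (forall x, typed tau v x) -> wt (heq A s t) ->
  den tau v (heq A s t) = top <-> den tau v s = den tau v t.
Proof.
move=> Hv; rewrite wt_heq => /and4P[ws /eqP es wt_t /eqP et].
by apply: (app_eqf HM); apply: den_in.
Qed.

Lemma den_alpha tau v v' e s t :
  all (fun p => p.1.2 == p.2.2) e ->
  (forall x y, alpha_var e x y -> v x = v' y) ->
  alpha_in e s t -> den tau v s = den tau v' t.
Proof.
elim: s t e v v' => [x|A|f IHf a IHa|x s IHs] [y|B|g b|y t] //= e v v' He Hv.
- exact: Hv.
- by move/eqP ->.
- by case/andP => /(IHf _ _ _ _ He Hv) -> /(IHa _ _ _ _ He Hv) ->.
- case/andP => xy st; have He' : all (fun p => p.1.2 == p.2.2) ((x, y) :: e) by rewrite /= xy.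
  rewrite (alpha_tyof He' st) (eqP xy); apply: eq_graph => a _.
  apply: (IHs _ _ _ _ He') st => x' y' /=; rewrite /update.
  by case: eqP => [_ ->//|_ /andP[/negbTE -> /Hv]].
Qed.

Lemma dty_subst tau r A :
  dty tau (ty_subst r A) = dty (fun X => dty tau (r X)) A.
Proof. by elim: A => //= A -> B ->. Qed.

(** Substitution amounts to composing assignments, for types and terms at once. Under a binder the
    renamed variable is not free in the terms put in place of the free variables, so updating it
    leaves their values unchanged. *)
Lemma den_subst tau v r s t : wt t ->
  (forall x, x \in fv t -> wt (s x) /\ tyof (s x) = ty_subst r x.2) ->
  den tau v (tm_subst r s t) =
  den (fun X => dty tau (r X)) (fun x => den tau v (s x)) t.
Proof.
elim: t v s => [x|A|f IHf a IHa|x t IHt] v s //=.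
- by move=> _ _; rewrite dty_subst.
- move=> /and3P[wf wa _] H.
  by rewrite IHf ?IHa // => y Hy; apply: H; rewrite mem_undup mem_cat Hy ?orbT.
move=> wt_t H; set avoid := flatten _; set x' := variant avoid _.
have x'2 : x'.2 = ty_subst r x.2 by rewrite variant_type.
have Hs y : y \in fv t -> wt (if y == x then HVar x' else s y) /\
    tyof (if y == x then HVar x' else s y) = ty_subst r y.2.
  move=> Hy; case: eqP => [->|/eqP yx] //; apply: H.
  by rewrite mem_filter yx.
rewrite (tyof_subst wt_t); last by move=> y /Hs[].
rewrite x'2 !dty_subst; apply: eq_graph => a _.
rewrite IHt //; apply: eq_den => // y Hy.
rewrite [RHS]/update; case: eqP => [_|/eqP yx] /=; first by rewrite /update eqxx.
have Hy' : y \in [seq z <- fv t | z != x] by rewrite mem_filter yx.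
have [wsy _] := H y Hy'; apply: eq_den => // z Hz.
rewrite /update; case: eqP => // e; have := variant_fresh avoid (x.1, ty_subst r x.2).
rewrite -/x' -e; case/negP; apply/flattenP; exists (fv (s y)) => //.
exact: (map_f (fun y => fv (s y))).
Qed.

Lemma valid_same s s' : same_sequent s s' -> valid M s' -> valid M s.
Proof.
move=> [eh ec] H tau v Htau Hv Hh; rewrite ec; apply: H => // h.
by rewrite -eh; apply: Hh.
Qed.

Lemma update_id v x : update v x (v x) = v.
Proof. by apply: funext => y; rewrite /update; case: eqP => [->|]. Qed.

Lemma wf_wt s t : wf_sequent s -> t \in concl s :: hyps s -> wt t.
Proof. by move/allP => H /H/andP[]. Qed.

(** Validity at one assignment. Most rules compare premises and conclusion at the same assignment;
    ABS, INST and INSTTYPE use the premise at another one. *)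
Definition holds tau v (s : hsequent) : Prop :=
  (forall h, h \in hyps s -> den tau v h = top) -> den tau v (concl s) = top.

Lemma holds_heq tau v G A s t : (forall x, typed tau v x) ->
  wf_sequent (HSequent G (heq A s t)) -> holds tau v (HSequent G (heq A s t)) <->
  ((forall h, h \in G -> den tau v h = top) -> den tau v s = den tau v t).
Proof.
move=> Hv /wf_wt/(_ (mem_head _ _))/(den_heq Hv) e.
by split=> H HG; apply/e; apply: H.
Qed.

Theorem hol_rule_valid ps s : hol_rule ps s ->
  (forall p, List.In p ps -> wf_sequent p) -> wf_sequent s ->
  (forall p, List.In p ps -> valid M p) -> valid M s.
Proof.
move=> R wfp wfs Hp tau v Htau Hv; rewrite -/(holds tau v s).
have Hps p : List.In p ps -> forall v', (forall x, typed tau v' x) -> holds tau v' p.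
  by move=> /Hp H v' Hv'; exact: (H tau v' Htau Hv').
have wf1 p : ps = [:: p] -> wf_sequent p by move=> e; apply: wfp; rewrite e; left.
have wf2 p q : ps = [:: p; q] -> wf_sequent p /\ wf_sequent q.
  by move=> e; split; apply: wfp; rewrite e; [left | right; left].
have Hcat (G D : seq tm) (P : tm -> Prop) : (forall h, h \in G ++ D -> P h) ->
    (forall h, h \in G -> P h) /\ (forall h, h \in D -> P h).
  by move=> H'; split=> h Hh; apply: H'; rewrite mem_cat Hh ?orbT.
case: ps s / R wfp wfs wf1 wf2 Hp Hps => /=.
- by move=> A t _ wfs _ _ _ _; apply/holds_heq.
- move=> G D A s t t' u alp _ wfs _ /(_ _ _ erefl)[w1 w2] _ Hp.
  have /(holds_heq Hv w1) H1 := Hp _ (or_introl erefl) v Hv.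
  have /(holds_heq Hv w2) H2 := Hp _ (or_intror (or_introl erefl)) v Hv.
  apply/holds_heq => // /Hcat[HG HD]; rewrite H1 // -H2 //.
  by apply: (den_alpha _ _ _ alp) => // x y /eqP ->.
- move=> G D A B s t u w _ wfs _ /(_ _ _ erefl)[w1 w2] _ Hp.
  have /(holds_heq Hv w1) H1 := Hp _ (or_introl erefl) v Hv.
  have /(holds_heq Hv w2) H2 := Hp _ (or_intror (or_introl erefl)) v Hv.
  by apply/holds_heq => // /Hcat[HG HD] /=; rewrite H1 // H2.
- move=> G B x s t HG _ wfs /(_ _ erefl) w1 _ _ Hp.
  apply/holds_heq => // Hh /=.
  (* Both bodies have type [B], so the two graphs have the same codomain and can be compared
     pointwise. *)
  have := wf_wt w1 (mem_head _ _); rewrite wt_heq => /and4P[_ /eqP -> _ /eqP ->].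
  apply: eq_graph => a Ha.
  have Hva y : typed tau (update v x a) y by apply: typed_update.
  have /(holds_heq Hva w1) := Hp _ (or_introl erefl) _ Hva; apply=> h hG.
  (* By the side condition [x] is not free in the hypotheses, so they keep their values under the
     update. *)
  rewrite -(Hh h hG); apply: eq_den => //.
    by apply: wf_wt w1 _; rewrite in_cons hG orbT.
  move=> y Hy; rewrite /update; case: eqP => // e.
  by move: (HG h hG); rewrite -e Hy.
- move=> B x t _ wfs _ _ _ _; apply/holds_heq => // _.
  have := wf_wt wfs (mem_head _ _); rewrite wt_heq => /and4P[_ _ wt_t _].
  by rewrite [LHS](den_beta HM) ?update_id //; apply: Hv.
- by move=> p _ wfs _ _ _ _ /(_ p); apply; rewrite mem_head.
- move=> G D p p' q alp _ wfs _ /(_ _ _ erefl)[w1 w2] _ Hp.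
  have /(holds_heq Hv w1) H1 := Hp _ (or_introl erefl) v Hv.
  have H2 := Hp _ (or_intror (or_introl erefl)) v Hv.
  move=> /Hcat[HG HD]; rewrite -[LHS]H1 // -(H2 HD).
  by apply: (den_alpha _ _ _ alp) => // x y /eqP ->.
- move=> G D p q _ wfs _ /(_ _ _ erefl)[w1 w2] _ Hp.
  have H1 := Hp _ (or_introl erefl) v Hv.
  have H2 := Hp _ (or_intror (or_introl erefl)) v Hv.
  apply/holds_heq => // /Hcat[HG HD].
  have [/andP[wp /eqP tp] _] := andP w1; have [/andP[wq /eqP tq] _] := andP w2.
  (* Truth values are equal once each being [top] forces the other to be; each premise gives one
     direction. *)
  apply: (bool_ext HM).
  + exact: (den_in (A := TyBool)).
  + exact: (den_in (A := TyBool)).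
  split=> e; [apply: H2 | apply: H1] => h; rewrite in_cons => /predU1P[->|] //.
  + exact: HD.
  + exact: HG.
- move=> G p l _ Hl _ wfs /(_ _ erefl) w1 _ _ Hp.
  pose s x := odflt (HVar x) (assoc l x).
  have Hs x : wt (s x) /\ tyof (s x) = ty_subst TyVar x.2.
    by rewrite ty_subst_var /s; case E: (assoc l x) => [t|] //=; apply/Hl/assoc_in.
  (* The premise of INST is used at the assignment giving each variable the value of the term put in
     its place. *)
  have Hv' x : typed tau (fun x => den tau v (s x)) x.
    have [wsx tsx] := Hs x; rewrite ty_subst_var in tsx.
    exact: den_in.
  have e t : wt t -> den tau v (term_inst l t) = den tau (fun x => den tau v (s x)) t.
    by move=> wt_t; rewrite /term_inst (den_subst _ _ wt_t (fun x _ => Hs x)).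
  move=> HG; rewrite [LHS]e; last exact: wf_wt w1 (mem_head _ _).
  apply: (Hp _ (or_introl erefl) _ Hv') => h Hh; rewrite -e; first by apply/HG/map_f.
  by apply: wf_wt w1 _; rewrite in_cons Hh orbT.
- move=> G p l _ _ wfs /(_ _ erefl) w1 _ Hp _.
  pose r X := odflt (TyVar X) (assoc l X).
  (* For INSTTYPE, type variables take the values of the types put in their place, and each variable
     that of its retyped version. *)
  pose tau' X := dty tau (r X); pose v' (x : hvar) := v (x.1, ty_subst r x.2).
  have Htau' X : exists a, a \in' tau' X by apply: (dty_nonempty HM).
  have Hv' x : typed tau' v' x.
    by have := Hv (x.1, ty_subst r x.2); rewrite /typed dty_subst.
  have e t : wt t -> den tau v (type_inst l t) = den tau' v' t.
    by move=> wt_t; rewrite /type_inst (den_subst _ _ wt_t).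
  move=> HG; rewrite [LHS]e; last exact: wf_wt w1 (mem_head _ _).
  apply: (Hp _ (or_introl erefl) tau' v' Htau' Hv') => h Hh.
  rewrite -e; first by apply/HG/map_f.
  by apply: wf_wt w1 _; rewrite in_cons Hh orbT.
- move=> A B x t xt _ wfs _ _ _ _; apply/holds_heq => // _.
  have := wf_wt wfs (mem_head _ _).
  rewrite wt_heq => /and4P[w1 /eqP t1 w2 /eqP t2].
  have xA : x.2 = A by case: t1.
  (* Extensionality in the function space; after beta, [t] keeps its value because [x] is not free
     in it. *)
  apply: (arr_ext HM (den_in Hv w1 t1) (den_in Hv w2 t2)) => a Ha.
  rewrite -xA in Ha; rewrite (den_beta HM) //.
  rewrite /= /update eqxx; congr (sop2 _ _ _); apply: eq_den => // y Hy.
  by case: eqP => // e; rewrite -e Hy in xt.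
Qed.
End Rules.

Theorem mainTheorem1 (nu : naming) (ps : seq hsequent) (s : hsequent) :
  hol_instance ps s ->
  (forall p, List.In p ps -> emb_provable nu p) ->
  emb_provable nu s.
Proof.
move=> [wfp wfs [ps' [s' [Hps Hs R]]]] Hp; apply/emb_provableP => // M HM.
have wf_same p q : same_sequent p q -> wf_sequent p -> wf_sequent q.
  move=> [eh ec] /allP H; apply/allP => t Ht; apply: H; move: Ht.
  by rewrite !in_cons ec eh.
have Hin p' : List.In p' ps' -> exists2 p, List.In p ps & same_sequent p p'.
  elim: {ps ps'} Hps {wfp Hp R} => // q q' ps ps' qq' _ IH [<-|/IH[r Hr rp']].
    by exists q => //; left.
  by exists r => //; right.
(* Well-formedness and validity see the hypotheses only as a set, so both pass between a sequent and
   its rearrangements. *)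
apply: (valid_same Hs); apply: (hol_rule_valid HM R) => [p' /Hin[p /wfp wf_p pp']||p' /Hin[p ip pp']].
- exact: wf_same pp' wf_p.
- exact: wf_same Hs wfs.
- have Hv := (emb_provableP nu (wfp p ip)).1 (Hp p ip) M HM.
  apply: (valid_same _ Hv); case: pp' => eh ec; split=> // x; by rewrite eh.
Qed.
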